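(* Let $\lambda\in\mathbb C$ with $\lambda^2\notin\mathbb R$. Then the Lie algebra $\mathfrak{gl}(\lambda)$ has no involutive anti-linear automorphisms, i.e., there is no $\mathbb R$-linear map $\omega:\mathfrak{gl}(\lambda)\to\mathfrak{gl}(\lambda)$ with $\omega(\alpha x)=\bar\alpha\,\omega(x)$, $\omega([x,y])=[\omega(x),\omega(y)]$ and $\omega^2=\mathrm{id}$ for all $\alpha\in\mathbb C$, $x,y\in\mathfrak{gl}(\lambda)$.
   Context: For $\lambda\in\mathbb C\setminus\mathbb Z$, let $\mathfrak A_\lambda=U(\mathfrak{sl}(2))/I_\lambda$, where $\mathfrak{sl}(2)$ has basis $X,H,Y$ with $[X,Y]=H$, $[H,X]=2X$, $[H,Y]=-2Y$, and $I_\lambda$ is the two-sided ideal generated by $2YX+\frac12H^2+H-\frac12(\lambda^2-1)$. $\mathfrak{gl}(\lambda)$ denotes $\mathfrak A_\lambda$ regarded as a Lie algebra with bracket $[a,b]=ab-ba$. *)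

(* Defs.v *)
From mathcomp Require Import all_boot all_algebra.
From mathcomp Require Import complex reals.
Set Implicit Arguments. Unset Strict Implicit. Unset Printing Implicit Defensive.
Import GRing.Theory Num.Theory.
Local Open Scope ring_scope.

(* Relations of sl(2) ([X,Y]=H, [H,X]=2X, [H,Y]=-2Y) together with the
   generator of I_lambda:  2YX + 1/2 H^2 + H - 1/2 (lambda^2 - 1) = 0. *)
Definition Alam_rel (R : realType) (lam : R[i]) (B : algType R[i])
  (X H Y : B) : Prop :=
  [/\ X * Y - Y * X = H,
      H * X - X * H = 2%:R *: X,
      H * Y - Y * H = - (2%:R *: Y)
    & 2%:R *: (Y * X) + 2%:R^-1 *: (H ^+ 2) + H
        - (2%:R^-1 * (lam ^+ 2 - 1)) *: 1 = 0].

Definition is_alg_hom (R : realType) (A B : algType R[i]) (f : A -> B) : Prop :=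
  [/\ forall x y, f (x + y) = f x + f y,
      forall (a : R[i]) x, f (a *: x) = a *: f x,
      forall x y, f (x * y) = f x * f y
    & f 1 = 1].

(* (A, X, H, Y) is a presentation of  A_lambda = U(sl(2)) / I_lambda:
   the relations hold, and A is universal among C-algebras with three
   elements satisfying them (i.e. A is the C-algebra generated by X, H, Y
   subject to the sl(2) relations and the Casimir relation). *)
Definition is_Alambda (R : realType) (lam : R[i]) (A : algType R[i])
  (X H Y : A) : Prop :=
  Alam_rel lam X H Y /\
  forall (B : algType R[i]) (X' H' Y' : B), Alam_rel lam X' H' Y' ->
    exists f : A -> B,
      [/\ is_alg_hom f, f X = X', f H = H', f Y = Y'
        & forall g : A -> B, is_alg_hom g -> g X = X' -> g H = H' ->
            g Y = Y' -> forall a, g a = f a].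

Definition lie_br (R : realType) (A : algType R[i]) (x y : A) : A :=
  x * y - y * x.

Definition is_inv_antilinear_lie_aut (R : realType) (A : algType R[i])
  (w : A -> A) : Prop :=
  [/\ forall x y, w (x + y) = w x + w y,
      forall (a : R[i]) x, w (a *: x) = a^* *: w x,
      forall x y, w (lie_br x y) = lie_br (w x) (w y)
    & forall x, w (w x) = x].

(* Main.v *)
(* Filter A_lambda so that its associated graded Poisson algebra is the even part of
   C[a, b], with X = a^2, H = ab, Y = b^2 and {a, b} constant.  Let h = w(H): ad h is
   locally finite, so for every choice of positive weights of a and b for which the top
   form F of h is heavier than ab, the operator {F, -} is locally nilpotent.  Evaluating
   F at a = 1 turns the iterates of {F, -} into one-variable polynomials, and comparing
   orders of vanishing at the roots of F shows that F is c (b - x a^k)^q, with k odd up to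
   exchanging a and b.  The automorphism b -> b + x a^k of A_lambda, that is
   exp(ad (t X^n)) with k = 2n - 1, then makes h smaller, and by descent there is a
   presentation X', H', Y' of A_lambda with the same lambda for which h is an affine
   function of H'.  A degree count then forces (wX, wH, wY) itself to be such a
   presentation.

   Now w(X^2) is a highest weight vector of weight 4 for (wX, wH, wY), hence c (wX)^2 for
   some c.  The components of [ad(Y) X^2, ad(Y)^2 X^2] along X and of
   [ad(Y)^2 X^2, ad(Y) X^3] along X^2 are proportional to lambda^2 - 4 and lambda^2 - 9,
   so the bars of these two numbers are their multiples by the same factor c^2; their
   difference is 5, so c^2 = 1 and lambda^2 is real. *)
Require Import Defs.
From HB Require Import structures.
From mathcomp Require Import all_boot all_algebra.
From mathcomp Require Import complex reals boolp.
From mathcomp Require Import zify ring.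
Import GRing.Theory Num.Theory.
Set Implicit Arguments. Unset Strict Implicit. Unset Printing Implicit Defensive.
Local Open Scope ring_scope.

(** The map [w] respects brackets but not products: a priori the images of [X], [H], [Y] are only an
    sl(2)-triple whose Casimir element is unknown, and only bracket expressions can be transported.
    What does survive is local finiteness of [ad H], and the whole descent is extracted from it.

    Top forms are made concrete by the action of A_lambda on densities on the line: [X] is d/dt, so
    its symbol xi is a^2, and t is b/a. The same action gives the linear independence of the
    monomials. As t has weight p - q, only weights with q <= p are available; the other half of the
    Newton polygon is reached by the swap (X, H, Y) -> (Y, -H, X).

    Nilpotency says nothing when the top form is no heavier than ab; the polygons left in that case
    are small and are treated by hand. The descent could also end at an h free of b, which is
    excluded by the eigenvector e = w(X) of ad h. *)

(** * The algebra of K-linear operators on symbols *)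

Section OperatorAlgebra.
Variable K : fieldType.

(** The coefficient ring of [{poly {poly K}}] is K[t], but d/dt is linear over K only; scalars
    therefore enter as constants [c%:P]. *)
Definition biscalar (f : {poly {poly K}} -> {poly {poly K}}) : Prop :=
  (forall u v, f (u + v) = f u + f v) /\
  (forall (c : K) u, f (c%:P *: u) = c%:P *: f u).

Record bop := Bop { bop_fun :> {poly {poly K}} -> {poly {poly K}};
                    bopP : biscalar bop_fun }.

Lemma bop_eq (f g : bop) : f =1 g -> f = g.
Proof.
case: f g => f fP [g gP] /= /funext fg; subst g.
by rewrite (Prop_irrelevance fP gP).
Qed.

HB.instance Definition _ := gen_eqMixin bop.
HB.instance Definition _ := gen_choiceMixin bop.

Lemma bopD (f : bop) u v : f (u + v) = f u + f v.
Proof. by case: f => f []. Qed.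
Lemma bopZ (f : bop) c u : f (c%:P *: u) = c%:P *: f u.
Proof. by case: f => f []. Qed.

Fact bop_zeroP : biscalar (fun _ => 0).
Proof. by split=> *; rewrite ?addr0 ?scaler0. Qed.
Fact bop_addP (f g : bop) : biscalar (fun u => f u + g u).
Proof. by split=> *; rewrite ?bopD ?bopZ ?scalerDr // addrACA. Qed.
Fact bop_oppP (f : bop) : biscalar (fun u => - f u).
Proof. by split=> *; rewrite ?bopD ?bopZ ?scalerN // opprD. Qed.
Fact bop_oneP : biscalar id.
Proof. by []. Qed.
Fact bop_mulP (f g : bop) : biscalar (fun u => f (g u)).
Proof. by split=> *; rewrite ?bopD ?bopZ. Qed.
Fact bop_scaleP c (f : bop) : biscalar (fun u => c%:P *: f u).
Proof. by split=> *; rewrite ?bopD ?bopZ ?scalerDr // !scalerA mulrC. Qed.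

Fact bop_addA : associative (fun f g => Bop (bop_addP f g)).
Proof. by move=> f g h; apply: bop_eq => u /=; rewrite addrA. Qed.
Fact bop_addC : commutative (fun f g => Bop (bop_addP f g)).
Proof. by move=> f g; apply: bop_eq => u /=; rewrite addrC. Qed.
Fact bop_add0 : left_id (Bop bop_zeroP) (fun f g => Bop (bop_addP f g)).
Proof. by move=> f; apply: bop_eq => u /=; rewrite add0r. Qed.
Fact bop_addN : left_inverse (Bop bop_zeroP) (fun f => Bop (bop_oppP f))
  (fun f g => Bop (bop_addP f g)).
Proof. by move=> f; apply: bop_eq => u /=; rewrite addNr. Qed.
HB.instance Definition _ :=
  GRing.isZmodule.Build bop bop_addA bop_addC bop_add0 bop_addN.

Fact bop_mulA : associative (fun f g => Bop (bop_mulP f g)).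
Proof. by move=> f g h; apply: bop_eq. Qed.
Fact bop_mul1 : left_id (Bop bop_oneP) (fun f g => Bop (bop_mulP f g)).
Proof. by move=> f; apply: bop_eq. Qed.
Fact bop_mulr1 : right_id (Bop bop_oneP) (fun f g => Bop (bop_mulP f g)).
Proof. by move=> f; apply: bop_eq. Qed.
Fact bop_mulDl : left_distributive (fun f g => Bop (bop_mulP f g)) +%R.
Proof. by move=> f g h; apply: bop_eq. Qed.
Fact bop_mulDr : right_distributive (fun f g => Bop (bop_mulP f g)) +%R.
Proof. by move=> f g h; apply: bop_eq => u /=; rewrite bopD. Qed.
Fact bop_1neq0 : Bop bop_oneP != 0.
Proof.
apply/eqP => /(congr1 (fun f : bop => f 1)) /= /eqP.
by rewrite (negPf (oner_neq0 _)).
Qed.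
HB.instance Definition _ := GRing.Zmodule_isNzRing.Build bop
  bop_mulA bop_mul1 bop_mulr1 bop_mulDl bop_mulDr bop_1neq0.

Fact bop_scaleA (a b : K) (f : bop) :
  Bop (bop_scaleP a (Bop (bop_scaleP b f))) = Bop (bop_scaleP (a * b) f).
Proof. by apply: bop_eq => u /=; rewrite scalerA polyCM. Qed.
Fact bop_scale1 : left_id 1 (fun a f => Bop (bop_scaleP a f)).
Proof. by move=> f; apply: bop_eq => u /=; rewrite polyC1 scale1r. Qed.
Fact bop_scaleDr : right_distributive (fun a f => Bop (bop_scaleP a f)) +%R.
Proof. by move=> a f g; apply: bop_eq => u /=; rewrite scalerDr. Qed.
Fact bop_scaleDl (f : bop) :
  {morph (fun a => Bop (bop_scaleP a f)) : a b / a + b}.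
Proof. by move=> a b; apply: bop_eq => u /=; rewrite polyCD scalerDl. Qed.
HB.instance Definition _ := GRing.Zmodule_isLmodule.Build K bop
  bop_scaleA bop_scale1 bop_scaleDr bop_scaleDl.

Fact bop_scaleAl (a : K) (f g : bop) : a *: (f * g) = (a *: f) * g.
Proof. exact: bop_eq. Qed.
HB.instance Definition _ := GRing.Lmodule_isLalgebra.Build K bop bop_scaleAl.
Fact bop_scaleAr (a : K) (f g : bop) : a *: (f * g) = f * (a *: g).
Proof. by apply: bop_eq => u /=; rewrite bopZ. Qed.
HB.instance Definition _ := GRing.Lalgebra_isAlgebra.Build K bop bop_scaleAr.

Lemma bop_mulE (f g : bop) u : (f * g) u = f (g u). Proof. by []. Qed.

End OperatorAlgebra.

(** * Composition of differential operators on the level of symbols *)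

Section StarProduct.
Variable K : fieldType.
Implicit Types (f g : {poly {poly K}}) (c : {poly K}).

Definition dt f : {poly {poly K}} := map_poly (@deriv K) f.

Lemma coef_dt f i : (dt f)`_i = (f`_i)^`().
Proof. exact: coef_map. Qed.

Lemma dtD f g : dt (f + g) = dt f + dt g.
Proof. exact: raddfD. Qed.

HB.instance Definition _ := GRing.isNmodMorphism.Build {poly {poly K}} {poly {poly K}} dt
  (raddf0 (map_poly (@deriv K)), dtD).

Lemma dtM f g : dt (f * g) = dt f * g + f * dt g.
Proof.
apply/polyP=> i; rewrite coefD !coef_dt !coefM raddf_sum -big_split /=.
by apply: eq_bigr => j _; rewrite !coef_dt derivM.
Qed.

Lemma dtZ c f : dt (c *: f) = c^`() *: f + c *: dt f.
Proof.
by apply/polyP=> i; rewrite coefD !coefZ !coef_dt coefZ derivM.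
Qed.

Lemma dtX : dt 'X = 0.
Proof.
apply/polyP=> i; rewrite coef_dt coefX coef0.
by case: (_ == _); rewrite ?derivC // -polyC1 derivC.
Qed.

Lemma dt_nderivn n f : dt (f^`N(n)) = (dt f)^`N(n).
Proof.
by apply/polyP=> i; rewrite coef_dt !coef_nderivn coef_dt derivMn.
Qed.

(* A polynomial in the outer variable xi with coefficients in K[t] stands for the
   differential operator in t whose normal-ordered symbol it is (xi stands for d/dt);
   star is the composition of operators. *)
Definition star g f : {poly {poly K}} := \sum_(k < size g) g^`N(k) * iter k dt f.

Lemma starE n g f : (size g <= n)%N ->
  star g f = \sum_(k < n) g^`N(k) * iter k dt f.
Proof.
move=> le_gn; rewrite /star [RHS](bigID (fun k : 'I_n => (k < size g)%N)) /=.
rewrite [X in _ = _ + X]big1 ?addr0.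
  by rewrite (big_ord_widen n (fun k => g^`N(k) * iter k dt f)).
by move=> k; rewrite -leqNgt => /nderivn_poly0 ->; rewrite mul0r.
Qed.

Lemma starDl g1 g2 f : star (g1 + g2) f = star g1 f + star g2 f.
Proof.
pose n := maxn (size g1) (size g2).
rewrite (@starE n (g1 + g2)) ?size_polyD // (@starE n g1) ?leq_maxl //.
rewrite (@starE n g2) ?leq_maxr // -big_split /=.
by apply: eq_bigr => k _; rewrite nderivnD mulrDl.
Qed.

Lemma starZl c g f : star (c *: g) f = c *: star g f.
Proof.
rewrite (@starE (size g)) ?size_scale_leq // scaler_sumr.
by apply: eq_bigr => k _; rewrite nderivnZ scalerAl.
Qed.

Lemma star1l f : star 1 f = f.
Proof. by rewrite /star size_poly1 big_ord1 nderivn0 mul1r. Qed.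

Lemma dt_star g f : dt (star g f) = star (dt g) f + star g (dt f).
Proof.
rewrite (@starE (size g) (dt g)) ?size_poly // raddf_sum -big_split /=.
by apply: eq_bigr => k _; rewrite dtM dt_nderivn -iterSr.
Qed.

(** In normal order xi g is g followed on the right by d/dt, which meets f through the Leibniz rule
    d/dt f = f d/dt + f'. *)
Lemma starXl g f : star ('X * g) f = 'X * star g f + star g (dt f).
Proof.
have hs : (size ('X * g)%R <= (size g).+1)%N.
  by rewrite mulrC; case: (eqVneq g 0) => [->|/size_mulX ->]; rewrite ?mul0r ?size_poly0.
rewrite (starE f hs) (@starE (size g).+1 g) // mulr_sumr.
rewrite big_ord_recl [X in _ = X + _]big_ord_recl /= !nderivn0 -addrA mulrA.
congr (_ + _); rewrite /star -big_split /=; apply: eq_bigr => k _.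
have := nderivnMXaddC k g 0; rewrite polyC0 addr0 mulrC => ->.
by rewrite mulrDl addrC -mulrA mulrCA -iterSr.
Qed.

Definition Dop f : {poly {poly K}} := dt f + 'X * f.

Lemma Dop_star g f : Dop (star g f) = star (Dop g) f.
Proof. by rewrite /Dop dt_star starDl starXl -addrA [_ + 'X * _]addrC. Qed.


Lemma DopD f g : Dop (f + g) = Dop f + Dop g.
Proof. by rewrite /Dop dtD mulrDr addrACA. Qed.

Lemma DopZ c f : Dop (c *: f) = c^`() *: f + c *: Dop f.
Proof. by rewrite /Dop dtZ scalerDr -scalerAr addrA. Qed.

Lemma DopN f : Dop (- f) = - Dop f.
Proof. by rewrite /Dop raddfN mulrN opprD. Qed.

Lemma DopZC (a : K) f : Dop (a%:P *: f) = a%:P *: Dop f.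
Proof. by rewrite DopZ derivC scale0r add0r. Qed.

(* The action of A_lambda on densities on the line: X = d/dt, H = - 2 t d/dt + a,
   Y = - t^2 d/dt + a t, in terms of symbols, with a = lambda - 1. *)
Fact Xop_biscalar : biscalar Dop.
Proof. by split; [exact: DopD | exact: DopZC]. Qed.
Definition Xop : bop K := Bop Xop_biscalar.

Fact Hop_biscalar (a : K) :
  biscalar (fun f => - (2%:R *: ('X *: Dop f)) + a%:P *: f).
Proof.
split=> [f g|b f]; rewrite ?DopD ?DopZC -!mul_polyC; ring.
Qed.
Definition Hop a : bop K := Bop (Hop_biscalar a).

Fact Yop_biscalar (a : K) :
  biscalar (fun f => - ('X^2 *: Dop f) + a%:P *: ('X *: f)).
Proof.
split=> [f g|b f]; rewrite ?DopD ?DopZC -!mul_polyC; ring.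
Qed.
Definition Yop a : bop K := Bop (Yop_biscalar a).

Lemma star_Xop g f : Xop (star g f) = star (Xop g) f.
Proof. exact: Dop_star. Qed.

Lemma starNl g f : star (- g) f = - star g f.
Proof. by rewrite -scaleN1r starZl scaleN1r. Qed.

Lemma star_Hop a g f : Hop a (star g f) = star (Hop a g) f.
Proof. by rewrite /= Dop_star [RHS]starDl starNl !starZl. Qed.

Lemma star_Yop a g f : Yop a (star g f) = star (Yop a g) f.
Proof. by rewrite /= Dop_star [RHS]starDl starNl !starZl. Qed.

End StarProduct.

(** * The defining relations for the operators on densities *)

Section WeylRelations.
Variables (K : numFieldType) (lam : K).
Variable D : {poly {poly K}} -> {poly {poly K}}.
Hypothesis DN : forall f, D (- f) = - D f.
Hypothesis DD : forall f g, D (f + g) = D f + D g.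
Hypothesis DZ : forall c f, D (c *: f) = c^`() *: f + c *: D f.

Let H f := - (2%:R *: ('X *: D f)) + (lam - 1)%:P *: f.
Let Y f := - ('X^2 *: D f) + (lam - 1)%:P *: ('X *: f).

Fact deriv2 : (2%:R : {poly K})^`() = 0.
Proof. by rewrite -[1]polyC1 -polyCMn derivC. Qed.

(** Only additivity and the Leibniz rule of [D] enter; with [D] opaque, each relation is a
    polynomial identity in u, D u and D (D u). *)
Lemma weyl_XY u : D (Y u) - Y (D u) = H u.
Proof.
rewrite /H /Y DD DN !DZ derivXn derivX !derivC -!mul_polyC /=; ring.
Qed.

Lemma weyl_HX u : H (D u) - D (H u) = 2%:R%:P *: D u.
Proof. rewrite /H DD DN !DZ deriv2 derivX !derivC -!mul_polyC; ring. Qed.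

Lemma weyl_HY u : H (Y u) - Y (H u) = - (2%:R%:P *: Y u).
Proof.
rewrite /H /Y !(DD, DN) !DZ derivXn deriv2 derivX !derivC -!mul_polyC; ring.
Qed.

Lemma weyl_casimir u :
  2%:R%:P *: Y (D u) + (2%:R^-1)%:P *: H (H u) + H u
    - (2%:R^-1 * (lam ^+ 2 - 1))%:P *: u = 0.
Proof.
have h2 : 2%:R * (2%:R^-1 : K)%:P%:P = 1 :> {poly {poly K}}.
  by rewrite -!polyCMn -!polyCM mulfV ?pnatr_eq0.
rewrite /H /Y !(DD, DN) !DZ deriv2 derivX !derivC -!mul_polyC.
move: h2; rewrite !polyCM; move: (_^-1)%:P%:P => r h2.
(* With r standing for 1/2, the left-hand side vanishes only modulo 2 r - 1; the displayed factor is
   its cofactor, so that [ring] needs no division. *)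
transitivity ((2%:R * r - 1) * (2%:R * 'X%:P ^+ 2 * D (D u)
  + 2%:R * 'X%:P * D u - 2%:R * (lam - 1)%:P%:P * 'X%:P * D u
  - (lam - 1)%:P%:P * u)); last by rewrite h2 subrr mul0r.
ring.
Qed.
End WeylRelations.


(** * Presentations and generation by X, H, Y *)

Section SubalgebraType.
Variables (K : fieldType) (A : algType K) (S : subalgClosed A).

Record subalg_of := SubalgOf { subalg_val : A; _ : subalg_val \in S }.
HB.instance Definition _ := [isSub for subalg_val].
HB.instance Definition _ := [Choice of subalg_of by <:].
HB.instance Definition _ := [SubChoice_isSubAlgebra of subalg_of by <:].

End SubalgebraType.

(* [Alam_rel], [is_alg_hom] and [is_Alambda] with R[i] replaced by any numeric field. *)
Section Presentation.
Variables (K : numFieldType) (lam : K).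

Definition sl2_rel (B : algType K) (X H Y : B) : Prop :=
  [/\ X * Y - Y * X = H,
      H * X - X * H = 2%:R *: X,
      H * Y - Y * H = - (2%:R *: Y)
    & 2%:R *: (Y * X) + 2%:R^-1 *: (H ^+ 2) + H
        - (2%:R^-1 * (lam ^+ 2 - 1)) *: 1 = 0].

Definition alg_hom (A B : algType K) (f : A -> B) : Prop :=
  [/\ forall x y, f (x + y) = f x + f y,
      forall (a : K) x, f (a *: x) = a *: f x,
      forall x y, f (x * y) = f x * f y
    & f 1 = 1].

Definition presents (A : algType K) (X H Y : A) : Prop :=
  sl2_rel X H Y /\
  forall (B : algType K) (X' H' Y' : B), sl2_rel X' H' Y' ->
    exists f : A -> B,
      [/\ alg_hom f, f X = X', f H = H', f Y = Y'
        & forall g : A -> B, alg_hom g -> g X = X' -> g H = H' ->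
            g Y = Y' -> forall a, g a = f a].

End Presentation.

Lemma op_sl2_rel (K : numFieldType) (lam : K) :
  sl2_rel lam (Xop _) (Hop (lam - 1)) (Yop (lam - 1)).
Proof.
have DN := @DopN K; have DD := @DopD K; have DZ := @DopZ K.
split; apply: bop_eq => u.
- exact: weyl_XY DN DD DZ u.
- exact: weyl_HX DN DD DZ u.
- exact: weyl_HY DN DD DZ u.
- exact: weyl_casimir DN DD DZ u.
Qed.

Lemma is_Alambda_presents (R : realType) (lam : R[i]) (A : algType R[i]) (X H Y : A) :
  is_Alambda lam X H Y -> presents lam X H Y.
Proof. by []. Qed.

Section Generation.
Variables (K : numFieldType) (lam : K) (A : algType K) (X H Y : A).
Hypothesis AP : presents lam X H Y.

(** Mapping A to the subalgebra by universality and back by inclusion fixes the generators, hence is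
    the identity by uniqueness. *)
Lemma presents_subalg (S : subalgClosed A) :
  X \in S -> H \in S -> Y \in S -> forall a, a \in S.
Proof.
move=> SX SH SY a; case: AP => rel univ.
pose x : subalg_of S := SubalgOf SX; pose h : subalg_of S := SubalgOf SH.
pose y : subalg_of S := SubalgOf SY.
have relS : sl2_rel lam x h y.
  by case: rel => r1 r2 r3 r4; split; apply: val_inj => /=.
have [f [[fD fZ fM f1] fX fH fY _]] := univ _ x h y relS.
have [g [_ _ _ _ gU]] := univ A X H Y rel.
have idf : a = val (f a).
  transitivity (g a); first exact: (gU id).
  symmetry; apply: (gU (fun b => val (f b))); rewrite ?fX ?fH ?fY //.
  by split=> *; rewrite ?fD ?fZ ?fM ?f1.
by rewrite idf; case: (f a).
Qed.

(** The elements whose left multiplication preserves P form a subalgebra containing the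
    generators. *)
Lemma presents_ind (P : A -> Prop) :
  P 1 -> (forall a b, P a -> P b -> P (a + b)) ->
  (forall c a, P a -> P (c *: a)) ->
  (forall a, P a -> P (X * a)) -> (forall a, P a -> P (H * a)) ->
  (forall a, P a -> P (Y * a)) -> forall a, P a.
Proof.
move=> P1 PD PZ PX PH PY.
pose S : {pred A} := [pred a | `[< forall b, P b -> P (a * b) >]].
have SP : GRing.subalg_closed S.
  split.
  - by apply/asboolP => b; rewrite mul1r.
  - move=> c u v /asboolP Pu /asboolP Pv; apply/asboolP => b Pb.
    by rewrite mulrDl -scalerAl; apply: PD; [apply/PZ/Pu | apply: Pv].
  - move=> u v /asboolP Pu /asboolP Pv; apply/asboolP => b Pb.
    by rewrite -mulrA; apply/Pu/Pv.
pose S' : subalgClosed A :=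
  HB.pack_for (subalgClosed A) S (GRing.isSubalgClosed.Build _ _ S SP).
move=> a; have /asboolP/(_ 1 P1) : a \in S'.
  by apply: presents_subalg; apply/asboolP.
by rewrite mulr1.
Qed.

End Generation.

(** * Weights, top forms and their Poisson bracket *)

Section WeightedSubstitution.
Variables (K : numFieldType) (m u : nat).
Hypothesis u_gt0 : (0 < u)%N.
Implicit Types (f g : {poly {poly K}}) (c d : {poly K}).

(* wsubst substitutes t T^m for t and T^u for xi: the degree in T measures the weight,
   and the top coefficient is the top form evaluated at xi = 1. *)
Definition wsubstC c : {poly {poly K}} :=
  (map_poly (polyC \o polyC) c).['X%:P * 'X^m].
Definition wsubst f : {poly {poly K}} := (map_poly wsubstC f).['X^u].

Fact wsubstC_nmod_morphism : GRing.nmod_morphism wsubstC.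
Proof.
by split=> [|c d]; rewrite /wsubstC ?rmorph0 ?horner0 // rmorphD hornerD.
Qed.
Fact wsubstC_monoid_morphism : GRing.monoid_morphism wsubstC.
Proof.
by split=> [|c d]; rewrite /wsubstC ?rmorph1 ?hornerC // rmorphM hornerM.
Qed.
HB.instance Definition _ :=
  GRing.isNmodMorphism.Build _ _ wsubstC wsubstC_nmod_morphism.
HB.instance Definition _ :=
  GRing.isMonoidMorphism.Build _ _ wsubstC wsubstC_monoid_morphism.

Fact wsubst_nmod_morphism : GRing.nmod_morphism wsubst.
Proof.
by split=> [|c d]; rewrite /wsubst ?rmorph0 ?horner0 // rmorphD hornerD.
Qed.
Fact wsubst_monoid_morphism : GRing.monoid_morphism wsubst.
Proof.
by split=> [|c d]; rewrite /wsubst ?rmorph1 ?hornerC // rmorphM hornerM.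
Qed.
HB.instance Definition _ :=
  GRing.isNmodMorphism.Build _ _ wsubst wsubst_nmod_morphism.
HB.instance Definition _ :=
  GRing.isMonoidMorphism.Build _ _ wsubst wsubst_monoid_morphism.

Lemma wsubstCC (k : K) : wsubstC k%:P = k%:P%:P.
Proof. by rewrite /wsubstC map_polyC hornerC. Qed.
Lemma wsubstCX : wsubstC 'X = 'X%:P * 'X^m.
Proof. by rewrite /wsubstC map_polyX hornerX. Qed.
Lemma wsubst_polyC c : wsubst c%:P = wsubstC c.
Proof. by rewrite /wsubst map_polyC hornerC. Qed.
Lemma wsubstX : wsubst 'X = 'X^u.
Proof. by rewrite /wsubst map_polyX hornerX. Qed.
Lemma wsubstZ (k : K) f : wsubst (k%:P *: f) = k%:P *: wsubst f.
Proof. by rewrite -!mul_polyC rmorphM /= wsubst_polyC wsubstCC. Qed.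

Lemma dtXn n : dt ('X^n : {poly {poly K}}) = 0.
Proof. by elim: n => [|n IH]; rewrite ?expr0 ?exprS ?dtM ?dtX ?IH ?mul0r ?mulr0 ?addr0 //;
  apply/polyP=> i; rewrite coef_dt coef1 coef0; case: (_ == _); rewrite ?deriv0 // -polyC1 derivC. Qed.

Lemma dt_polyC c : dt c%:P = (c^`())%:P.
Proof. by apply/polyP=> i; rewrite coef_dt !coefC; case: (_ == _); rewrite ?deriv0. Qed.

Lemma wsubstC_dt c : 'X^m * wsubstC c^`() = dt (wsubstC c).
Proof.
elim/poly_ind: c => [|c k IH]; first by rewrite !(raddf0, rmorph0, mulr0).
rewrite derivD derivM derivX derivC !(rmorphD, rmorphM) /= wsubstCX wsubstCC rmorph0 rmorph1.
rewrite dtD dtM -IH dtM dtXn !dt_polyC derivX derivC polyC0 polyC1; ring.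
Qed.

Lemma wsubst_dt f : 'X^m * wsubst (dt f) = dt (wsubst f).
Proof.
elim/poly_ind: f => [|f c IH]; first by rewrite !(raddf0, rmorph0, mulr0).
rewrite dtD dtM dtX mulr0 addr0 dt_polyC !(rmorphD, rmorphM) /= !wsubst_polyC wsubstX.
rewrite dtD dtM dtXn -IH -wsubstC_dt; ring.
Qed.

Lemma wsubstC_euler c :
  'X * (wsubstC c)^`() = m%:R * 'X%:P * dt (wsubstC c).
Proof.
elim/poly_ind: c => [|c k IH].
  by rewrite rmorph0 deriv0 mulr0 raddf0 mulr0.
rewrite !(rmorphD, rmorphM) /= wsubstCX wsubstCC !dtD !dtM dtXn !dt_polyC.
rewrite derivD !derivM !derivC derivX derivXn polyC0 polyC1.
rewrite !mul0r !mulr0 !addr0 !add0r.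
rewrite mulrDr mulrA IH -mulr_natl.
case: m => [|n]; first by rewrite !mulr0 !mul0r ?addr0.
rewrite /= exprS; ring.
Qed.

(** Euler's formula T d/dT = m t d/dt + u xi d/dxi, solved for the xi-derivative. It is what allows
    top forms to be handled at xi = 1, as polynomials in t alone. *)
Lemma wsubst_euler f :
  u%:R * ('X^u * wsubst f^`()) =
  'X * (wsubst f)^`() - m%:R * 'X%:P * dt (wsubst f).
Proof.
elim/poly_ind: f => [|f c IH].
  by rewrite deriv0 !rmorph0 deriv0 !mulr0 [dt 0]raddf0 mulr0 subr0.
rewrite derivD derivM derivX derivC !(rmorphD, rmorphM) /= !wsubst_polyC wsubstX.
rewrite rmorph0 rmorph1 addr0 mulr1 derivD derivM derivXn dtD dtM dtXn !mulr0 addr0.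
rewrite -mulr_natl.
have XX : 'X * ('X^(u.-1) : {poly {poly K}}) = 'X^u by rewrite -exprS prednK.
have Ec := wsubstC_euler c.
have Ef : 'X * (wsubst f)^`() = u%:R * ('X^u * wsubst f^`()) + m%:R * 'X%:P * dt (wsubst f).
  by rewrite IH subrK.
transitivity ('X * (wsubst f)^`() * 'X^u
  + wsubst f * (u%:R * ('X * ('X^(u.-1)))) + 'X * (wsubstC c)^`()
  - m%:R * 'X%:P * (dt (wsubst f) * 'X^u + dt (wsubstC c))); last by ring.
rewrite XX Ef Ec; ring.
Qed.

Definition tmono (k : K) i j : {poly {poly K}} := (k%:P * 'X^i)%:P * 'X^j.

Lemma wsubst_tmono k i j :
  wsubst (tmono k i j) = (k%:P * 'X^i) *: 'X^(m * i + u * j).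
Proof.
have wM f g : wsubst (f * g) = wsubst f * wsubst g := rmorphM _ f g.
have wX f n : wsubst (f ^+ n) = wsubst f ^+ n := rmorphXn _ n f.
have cM c d : wsubstC (c * d) = wsubstC c * wsubstC d := rmorphM _ c d.
have cX c n : wsubstC (c ^+ n) = wsubstC c ^+ n := rmorphXn _ n c.
rewrite /tmono wM wX wsubstX wsubst_polyC cM cX wsubstCX wsubstCC.
rewrite -mul_polyC polyCM polyC_exp exprMn -!exprM exprD; ring.
Qed.

End WeightedSubstitution.

Lemma size_mul_bound (S : nzRingType) (p q : {poly S}) M N :
  (size p <= M.+1)%N -> (size q <= N.+1)%N -> (size (p * q)%R <= (M + N).+1)%N.
Proof. by move=> hp hq; apply: leq_trans (size_polyMleq p q) _; lia. Qed.

Lemma coef_mul_top (S : nzRingType) (p q : {poly S}) M N :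
  (size p <= M.+1)%N -> (size q <= N.+1)%N -> (p * q)`_(M + N) = p`_M * q`_N.
Proof.
move=> hp hq; have hM : (M < (M + N).+1)%N by lia.
rewrite coefM (bigD1 (Ordinal hM)) //= addKn big1 ?addr0 // => j /eqP jM.
have {}jM : nat_of_ord j <> M by move=> e; apply: jM; apply: val_inj.
have [jltM|] := ltnP j M; last move=> Mlej.
  by rewrite [q`__]nth_default ?mulr0 //; apply: leq_trans hq _; lia.
by rewrite [p`__]nth_default ?mul0r //; apply: leq_trans hp _; lia.
Qed.

Section WeightedBracket.
Variables (K : numFieldType) (m u : nat).
Hypothesis u_gt0 : (0 < u)%N.
Implicit Types (f g : {poly {poly K}}) (c d : {poly K}).
Local Notation W := (wsubst m u).

Lemma size_natmul n f : (0 < n)%N -> size (n%:R * f) = size f.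
Proof.
move=> n0; rewrite -[n%:R](rmorph_nat polyC) mul_polyC size_scale //.
by rewrite -polyC_natr polyC_eq0 pnatr_eq0 -lt0n.
Qed.

Lemma size_dt f : (size (dt f) <= size f)%N.
Proof. exact: size_poly. Qed.

Lemma size_wsubst_dt f : (size ('X^m * W (dt f))%R <= size (W f))%N.
Proof. by rewrite wsubst_dt // size_dt. Qed.

Lemma size_Xderiv f : (size ('X * f^`())%R <= size f)%N.
Proof.
have [->|f0] := eqVneq f 0; first by rewrite deriv0 mulr0.
rewrite mulrC; have [->|d0] := eqVneq f^`() 0; first by rewrite mul0r size_poly0.
by rewrite size_mulX // lt_size_deriv.
Qed.

Lemma size_wsubst_deriv f : (size ('X^u * W f^`())%R <= size (W f))%N.
Proof.
rewrite -(size_natmul _ u_gt0) wsubst_euler //.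
apply: leq_trans (size_polyD _ _) _; rewrite geq_max size_Xderiv size_polyN /=.
rewrite -[m%:R](rmorph_nat polyC) -rmorphM mul_polyC.
exact: leq_trans (size_scale_leq _ _) (size_dt _).
Qed.

Lemma size_mulXn_mono n f g :
  (size f <= size g)%N -> (size ('X^n * f)%R <= size ('X^n * g)%R)%N.
Proof.
have [->|f0] := eqVneq f 0; first by rewrite mulr0 size_poly0.
have [->|g0] := eqVneq g 0; first by rewrite size_poly0 leqn0 size_poly_eq0 (negPf f0).
by rewrite !['X^n * _]mulrC !size_mulXn // leq_add2l.
Qed.

Lemma size_wsubst_dtn k f :
  (size ('X^(m * k) * W (iter k (@dt K) f))%R <= size (W f))%N.
Proof.
elim: k => [|k IH]; first by rewrite muln0 mul1r.
apply: leq_trans IH; rewrite mulnS addnC exprD -mulrA.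
exact/size_mulXn_mono/size_wsubst_dt.
Qed.

Lemma size_wsubst_nderivn k f :
  (size ('X^(u * k) * W f^`N(k))%R <= size (W f))%N.
Proof.
have -> : size ('X^(u * k) * W f^`N(k)) = size ('X^(u * k) * W f^`(k)).
  rewrite nderivn_def rmorphMn /= -mulr_natl mulrCA size_natmul //.
  exact: fact_gt0.
elim: k => [|k IH]; first by rewrite muln0 mul1r derivn0.
apply: leq_trans IH; rewrite mulnS addnC exprD -mulrA derivnS.
exact/size_mulXn_mono/size_wsubst_deriv.
Qed.

(** Each d/dxi costs u and each d/dt costs m, so term k of [star] lies at least (m + u) k below the
    product. Term 0 is commutative and cancels in a bracket; term 1 gives the Poisson bracket. *)
Lemma coef_star_term k g f M N i :
  (size (W g) <= M.+1)%N -> (size (W f) <= N.+1)%N ->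
  (M + N < i + (m + u) * k)%N ->
  (W g^`N(k) * W (iter k (@dt K) f))`_i = 0.
Proof.
move=> hg hf hi.
have -> : (W g^`N(k) * W (iter k (@dt K) f))`_i =
  (('X^(u * k) * W g^`N(k)) * ('X^(m * k) * W (iter k (@dt K) f)))`_(i + (m + u) * k).
  by rewrite mulrACA -exprD -mulnDl [(u + m)%N]addnC [(i + _)%N]addnC
    coefXnM ltnNge leq_addr /= addKn.
have s := size_mul_bound (leq_trans (size_wsubst_nderivn k g) hg)
  (leq_trans (size_wsubst_dtn k f) hf).
by rewrite nth_default //; apply: leq_trans s _.
Qed.

Lemma coef_wsubst_star g f M N i :
  (size (W g) <= M.+1)%N -> (size (W f) <= N.+1)%N ->
  (M + N < i + (m + u) * 2)%N ->
  (W (star g f))`_i = (W g * W f)`_i + (W g^`() * W (dt f))`_i.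
Proof.
move=> hg hf hi.
rewrite (@starE _ (size g).+2) ?leqW // !big_ord_recl /= !rmorphD !rmorphM /=.
rewrite nderivn0 nderivn1 !coefD addrA rmorph_sum coef_sum big1 ?addr0 // => k _.
rewrite rmorphM /=; apply: (@coef_star_term k.+2 g f M N i hg hf).
by apply: leq_trans hi _; rewrite leq_add2l leq_mul2l; apply/orP; right.
Qed.

Definition bracket_symbol g f := star g f - star f g.

Lemma wsubst_bracket_coef g f M N i :
  (size (W g) <= M.+1)%N -> (size (W f) <= N.+1)%N ->
  (M + N <= i + (m + u))%N ->
  (W (bracket_symbol g f))`_i =
    (W g^`() * W (dt f))`_i - (W f^`() * W (dt g))`_i.
Proof.
move=> hg hf hi; rewrite rmorphB coefB /=.
rewrite (coef_wsubst_star hg hf) ?(coef_wsubst_star hf hg); try by lia.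
by rewrite [W f * W g]mulrC opprD addrACA subrr add0r.
Qed.

Lemma wsubst_bracket_size g f M N i :
  (size (W g) <= M.+1)%N -> (size (W f) <= N.+1)%N ->
  (M + N < i + (m + u))%N -> (W (bracket_symbol g f))`_i = 0.
Proof.
move=> hg hf hi; rewrite (wsubst_bracket_coef hg hf) ?(ltnW hi) //.
have := @coef_star_term 1 g f M N i hg hf; rewrite muln1 /= nderivn1 => -> //.
have := @coef_star_term 1 f g N M i hf hg; rewrite muln1 /= nderivn1 => -> //.
  by rewrite subr0.
by rewrite addnC.
Qed.

(** Both factors u and m come from Euler's formula. The part containing m is symmetric in f and g,
    so it disappears from the bracket. *)
Lemma coef_wsubst_poisson g f M N i :
  (size (W g) <= M.+1)%N -> (size (W f) <= N.+1)%N -> (M + N = i + (m + u))%N ->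
  u%:R * (W g^`() * W (dt f))`_i =
   (M%:R * (W g)`_M - m%:R * 'X * ((W g)`_M)^`()) * ((W f)`_N)^`().
Proof.
move=> hg hf hi.
have -> : u%:R * (W g^`() * W (dt f))`_i =
  ((u%:R * ('X^u * W g^`())) * ('X^m * W (dt f)))`_(M + N).
  have -> : (u%:R * ('X^u * W g^`())) * ('X^m * W (dt f)) =
    'X^(m + u) * (u%:R * (W g^`() * W (dt f))) by rewrite exprD; ring.
  rewrite hi [(i + _)%N]addnC coefXnM ltnNge leq_addr /= addKn.
  by rewrite -[in RHS](rmorph_nat polyC) coefCM.
rewrite coef_mul_top; first last.
- exact: leq_trans (size_wsubst_dt f) hf.
- by rewrite size_natmul //; exact: leq_trans (size_wsubst_deriv g) hg.
rewrite wsubst_dt coef_dt wsubst_euler // coefB; congr ((_ - _) * _).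
  rewrite coefXM coef_deriv; case: M {hi} hg => [|M] hg /=; first by rewrite mul0r.
  by rewrite mulr_natl.
by rewrite -[X in X * _ * _](rmorph_nat polyC) -rmorphM coefCM coef_dt.
Qed.

Lemma wsubst_bracket_top g f M N i :
  (size (W g) <= M.+1)%N -> (size (W f) <= N.+1)%N -> (M + N = i + (m + u))%N ->
  u%:R * (W (bracket_symbol g f))`_i =
   M%:R * (W g)`_M * ((W f)`_N)^`() - N%:R * ((W g)`_M)^`() * (W f)`_N.
Proof.
move=> hg hf hi; rewrite (wsubst_bracket_coef hg hf) ?hi // mulrBr.
rewrite (coef_wsubst_poisson hg hf hi) (@coef_wsubst_poisson f g N M) //.
  ring.
by rewrite addnC.
Qed.

End WeightedBracket.

Definition br (S : pzRingType) (x y : S) : S := x * y - y * x.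

(** * The symbol map on A_lambda *)

Section Symbol.
Variables (K : numFieldType) (lam : K) (A : algType K).
Implicit Types (X H Y a b : A) (s : A -> {poly {poly K}}).

Definition is_symbol X H Y s : Prop :=
  [/\ forall a b, s (a + b) = s a + s b,
      forall (k : K) a, s (k *: a) = k%:P *: s a,
      forall a b, s (a * b) = star (s a) (s b)
    & [/\ s 1 = 1, s X = tmono 1 0 1,
        s H = tmono (- 2%:R) 1 1 + tmono (lam - 1) 0 0
        & s Y = tmono (- 1) 2 1 + tmono (lam - 1) 1 0]].

(** Every operator in the image is a left composition v -> star (s a) v, since this holds for the
    generators; it is therefore determined by its value at 1, which is taken as the symbol. *)
Lemma presents_symbol X H Y : presents lam X H Y -> exists s, is_symbol X H Y s.
Proof.
move=> AP; case: (AP) => _ univ.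
have [f [[fD fZ fM f1] fX fH fY _]] := univ _ _ _ _ (op_sl2_rel lam).
exists (fun a => f a 1).
have fstar a v : f a v = star (f a 1) v.
  elim/(presents_ind AP) : a v => [v|a b IHa IHb v|k a IH v|a IH v|a IH v|a IH v].
  - by rewrite f1 star1l.
  - by rewrite fD /= starDl -IHa -IHb.
  - by rewrite fZ /= starZl -IH.
  - by rewrite fM fX !bop_mulE IH star_Xop.
  - by rewrite fM fH !bop_mulE IH star_Hop.
  - by rewrite fM fY !bop_mulE IH star_Yop.
have D1 : Dop (1 : {poly {poly K}}) = 'X.
  rewrite /Dop mulr1 -polyC1 /dt map_polyC /= -polyC1 derivC.
  by rewrite /= polyC0 add0r.
split=> [a b|k a|a b|].
- by rewrite fD.
- by rewrite fZ.
- by rewrite fM bop_mulE fstar.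
rewrite f1 fX fH fY /= D1 /tmono !expr0 !expr1 !mulr1 -!mul_polyC.
split=> //; first by rewrite polyC1 mul1r.
  by rewrite mulr1 mulrA !polyCN mulNr !polyCN mulNr !rmorph_nat polyCM !rmorph_nat.
ring.
Qed.

Section Weights.
Variables (X H Y : A) (s : A -> {poly {poly K}}).
Hypothesis sP : is_symbol X H Y s.
Variables (p q : nat).
Hypotheses (q_gt0 : (0 < q)%N) (qp : (q <= p)%N).

(* X, H, Y get the weights 2q, p+q, 2p of a^2, ab, b^2 when a, b have weights q, p. *)
Definition wsym a := wsubst (p - q) (2 * q) (s a).
Definition wle N a := (size (wsym a) <= N.+1)%N.
Definition tp N a : {poly K} := (wsym a)`_N.

Let u_gt0 : (0 < 2 * q)%N. Proof. by rewrite muln_gt0. Qed.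
Let mu : (p - q + 2 * q = p + q)%N. Proof. by lia. Qed.

Lemma wsymD a b : wsym (a + b) = wsym a + wsym b.
Proof. by case: sP => sD _ _ _; rewrite /wsym sD rmorphD. Qed.
Lemma wsymZ k a : wsym (k *: a) = k%:P *: wsym a.
Proof. by case: sP => _ sZ _ _; rewrite /wsym sZ wsubstZ. Qed.
Lemma wsym0 : wsym 0 = 0.
Proof. by rewrite -(scale0r 0) wsymZ polyC0 scale0r. Qed.
Lemma wsym_sum (I : Type) (r : seq I) (P : pred I) (F : I -> A) :
  wsym (\sum_(i <- r | P i) F i) = \sum_(i <- r | P i) wsym (F i).
Proof. exact: (big_morph _ wsymD wsym0). Qed.

Lemma wle_tp0 N M a : wle N a -> (N < M)%N -> tp M a = 0.
Proof. by move=> h NM; rewrite /tp nth_default //; apply: leq_trans h _. Qed.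

Lemma wleW N M a : wle N a -> (N <= M)%N -> wle M a.
Proof. by move=> h NM; apply: leq_trans h _. Qed.

Lemma wleP N a : (forall M, (N < M)%N -> tp M a = 0) -> wle N a.
Proof. by move=> h; apply/leq_sizeP => j; apply: h. Qed.

Lemma wleD N a b : wle N a -> wle N b -> wle N (a + b).
Proof.
move=> ha hb; rewrite /wle wsymD.
by apply: leq_trans (size_polyD _ _) _; rewrite geq_max; apply/andP; split.
Qed.
Lemma wleZ N k a : wle N a -> wle N (k *: a).
Proof. by move=> ha; rewrite /wle wsymZ; apply: leq_trans (size_scale_leq _ _) ha. Qed.
Lemma wle0 N : wle N 0.
Proof. by rewrite /wle wsym0 size_poly0. Qed.
Lemma wle_sum N (I : finType) (P : pred I) (F : I -> A) :
  (forall i, P i -> wle N (F i)) -> wle N (\sum_(i | P i) F i).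
Proof. by move=> h; elim/big_ind: _ => [|a b|//]; [exact: wle0|exact: wleD]. Qed.

Lemma tp0 N : tp N 0 = 0.
Proof. by rewrite /tp wsym0 coef0. Qed.
Lemma tpD N a b : tp N (a + b) = tp N a + tp N b.
Proof. by rewrite /tp wsymD coefD. Qed.
Lemma tpZ N k a : tp N (k *: a) = k%:P * tp N a.
Proof. by rewrite /tp wsymZ coefZ. Qed.
Lemma tp_sum N (I : finType) (P : pred I) (F : I -> A) :
  tp N (\sum_(i | P i) F i) = \sum_(i | P i) tp N (F i).
Proof. by rewrite /tp wsym_sum coef_sum. Qed.

Lemma wsymM_coef M N a b i : wle M a -> wle N b -> (M + N <= i)%N ->
  tp i (a * b) = (wsym a * wsym b)`_i.
Proof.
move=> ha hb hi; case: sP => _ _ sM _; rewrite /tp /wsym sM.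
rewrite (coef_wsubst_star u_gt0 ha hb) ?mu; last by lia.
have := @coef_star_term _ (p - q) _ u_gt0 1 (s a) (s b) M N i ha hb.
rewrite muln1 mu nderivn1 /= => -> //; first by rewrite addr0.
by lia.
Qed.

Lemma wleM M N a b : wle M a -> wle N b -> wle (M + N) (a * b).
Proof.
move=> ha hb; apply: wleP => i hi; rewrite (wsymM_coef ha hb) ?(ltnW hi) //.
by rewrite nth_default //; apply: leq_trans (size_mul_bound ha hb) _.
Qed.

Lemma tpM M N a b : wle M a -> wle N b -> tp (M + N) (a * b) = tp M a * tp N b.
Proof. by move=> ha hb; rewrite (wsymM_coef ha hb) // coef_mul_top. Qed.

Lemma wle1 : wle 0 1.
Proof. by case: sP => _ _ _ [s1 *]; rewrite /wle /wsym s1 rmorph1 size_poly1. Qed.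
Lemma tp1 : tp 0 1 = 1.
Proof. by case: sP => _ _ _ [s1 *]; rewrite /tp /wsym s1 rmorph1 coef1. Qed.

Lemma wleX_tp N n a : wle N a -> wle (n * N) (a ^+ n) /\ tp (n * N) (a ^+ n) = tp N a ^+ n.
Proof.
move=> ha; elim: n => [|n [IHw IHt]]; first by rewrite !expr0; split; [exact: wle1|exact: tp1].
by rewrite !exprS mulSn; split; [exact: wleM | rewrite tpM // IHt].
Qed.

Lemma size_scaleXn (k : {poly K}) n N : (n <= N)%N ->
  (size (k *: 'X^n : {poly {poly K}}) <= N.+1)%N.
Proof. by move=> h; rewrite (leq_trans (size_scale_leq _ _)) ?size_polyXn. Qed.

Lemma wsymX : wsym X = 'X^(2 * q).
Proof.
case: sP => _ _ _ [_ sX _ _].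
by rewrite /wsym sX wsubst_tmono polyC1 mul1r scale1r muln0 muln1.
Qed.

Lemma wsymH : wsym H =
  (- 2%:R * 'X) *: 'X^(p + q) + (lam - 1)%:P *: 'X^0.
Proof.
case: sP => _ _ _ [_ _ sH _]; have wD f g : wsubst (p - q) (2 * q) (f + g) = wsubst (p - q) (2 * q) f
  + wsubst (p - q) (2 * q) g := rmorphD (wsubst (p - q) (2 * q)) f g.
by rewrite /wsym sH wD !wsubst_tmono !muln1 !muln0 mu polyCN rmorph_nat mulr1 expr1.
Qed.

Lemma wsymY : wsym Y =
  (- 'X^2) *: 'X^(2 * p) + ((lam - 1)%:P * 'X) *: 'X^(p - q).
Proof.
case: sP => _ _ _ [_ _ _ sY]; have wD f g : wsubst (p - q) (2 * q) (f + g) = wsubst (p - q) (2 * q) f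
  + wsubst (p - q) (2 * q) g := rmorphD (wsubst (p - q) (2 * q)) f g.
rewrite /wsym sY wD !wsubst_tmono polyCN polyC1 mulN1r expr1 !muln1 muln0 addn0.
by congr (_ *: 'X^_ + _); lia.
Qed.

Lemma wle_gens : [/\ wle (2 * q) X, wle (p + q) H & wle (2 * p) Y].
Proof.
rewrite /wle wsymX wsymH wsymY; split; first by rewrite size_polyXn.
  apply: leq_trans (size_polyD _ _) _; rewrite geq_max.
  by rewrite !size_scaleXn.
apply: leq_trans (size_polyD _ _) _; rewrite geq_max.
by rewrite !size_scaleXn //; lia.
Qed.

Lemma tp_gens : [/\ tp (2 * q) X = 1, tp (p + q) H = - 2%:R * 'X & tp (2 * p) Y = - 'X^2].
Proof.
rewrite /tp wsymX wsymH wsymY !coefD !coefZ !coefXn !eqxx !mulr1.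
have -> : (p + q == 0)%N = false by lia.
have -> : (2 * p == p - q)%N = false by lia.
by rewrite !mulr0 !addr0.
Qed.

Lemma br_symbol a b : s (br a b) = bracket_symbol (s a) (s b).
Proof.
case: sP => sD sZ sM _.
by rewrite /br -scaleN1r sD sZ !sM polyCN polyC1 scaleN1r.
Qed.

Lemma br_tp0 M N a b i : wle M a -> wle N b -> (M + N < i + (p + q))%N ->
  tp i (br a b) = 0.
Proof.
by move=> ha hb hi; rewrite /tp /wsym br_symbol (wsubst_bracket_size u_gt0 ha hb) ?mu.
Qed.

(** The right-hand side is, up to a constant, the Poisson bracket of the two top forms at a = 1. Its
    weight i = M + N - (p + q) is given additively to avoid truncated subtraction. *)
Lemma br_tp M N a b i : wle M a -> wle N b -> (M + N = i + (p + q))%N ->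
  wle i (br a b) /\
  (2 * q)%:R * tp i (br a b)
     = M%:R * tp M a * (tp N b)^`() - N%:R * (tp M a)^`() * tp N b.
Proof.
move=> ha hb hi; split.
  by apply: wleP => j hj; apply: (br_tp0 ha hb); lia.
by rewrite /tp /wsym br_symbol (wsubst_bracket_top u_gt0 ha hb) ?mu.
Qed.

End Weights.
End Symbol.

Section Relations.
Variables (K : numFieldType) (lam : K) (A : algType K) (X H Y : A).
Hypothesis rel : sl2_rel lam X H Y.

Lemma rel_XY : X * Y = Y * X + H.
Proof. by case: rel => r _ _ _; rewrite -r addrC subrK. Qed.
Lemma rel_HX : H * X = X * H + 2%:R *: X.
Proof. by case: rel => _ r _ _; rewrite -r addrC subrK. Qed.
Lemma rel_HY : H * Y = Y * H - 2%:R *: Y.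
Proof. by case: rel => _ _ r _; rewrite -r addrC subrK. Qed.

Lemma rel_YX : Y * X = (4%:R^-1 * (lam ^+ 2 - 1)) *: 1 - 2%:R^-1 *: H
  - 4%:R^-1 *: (H * H).
Proof.
case: rel => _ _ _ r.
have n2 : 2%:R != 0 :> K by rewrite pnatr_eq0.
have n4 : 4%:R = 2%:R * 2%:R :> K by rewrite -natrM.
apply: (scalerI n2); rewrite !scalerBr !scalerA n4 invfM.
rewrite -mulrA mulVKf // [2%:R * (2%:R^-1 / 2%:R)]mulVKf // mulfV // scale1r.
move/eqP: r; rewrite subr_eq0 expr2 => /eqP <-.
by rewrite addrK addrK.
Qed.

Lemma rel_HXn n : H * X ^+ n = X ^+ n * H + (2 * n)%:R *: X ^+ n.
Proof.
elim: n => [|n IH]; first by rewrite muln0 scale0r addr0 expr0 mulr1 mul1r.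
rewrite exprSr mulrA IH mulrDl -mulrA rel_HX mulrDr -scalerAl -scalerAr mulrA -addrA.
by rewrite -scalerDl -natrD mulnS addnC.
Qed.

Lemma rel_HYn n : H * Y ^+ n = Y ^+ n * H - (2 * n)%:R *: Y ^+ n.
Proof.
elim: n => [|n IH]; first by rewrite muln0 scale0r subr0 expr0 mulr1 mul1r.
rewrite exprSr mulrA IH mulrBl -(mulrA _ H Y) rel_HY mulrBr -scalerAl -scalerAr mulrA -addrA.
by rewrite -opprD -scalerDl -natrD mulnS addnC.
Qed.

End Relations.

(** * Expansion of elements in monomials *)

Section Monomials.
Variables (K : numFieldType) (A : algType K).

(* The monomial with symbol a^i b^j (up to a scalar), where X = a^2, H = ab, Y = b^2;
   meaningful for i + j even only. *)
Definition Z (X H Y : A) (i j : nat) : A :=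
  if (j <= i)%N then X ^+ (i - j)./2 * H ^+ j else Y ^+ (j - i)./2 * H ^+ i.

(** The table [c] is total and its support is confined by the first clause, so [n] can be enlarged
    freely; the parity clause keeps to the pairs where the halved exponent in [Z] is exact. *)
Definition expands (X H Y : A) (c : nat -> nat -> K) (n : nat) (a : A) : Prop :=
  (forall i j, c i j != 0 -> [&& ~~ odd (i + j), i < n & j < n]%N) /\
  a = \sum_(i < n) \sum_(j < n) c i j *: Z X H Y i j.

Lemma expandsW X H Y c n m a : expands X H Y c n a -> (n <= m)%N ->
  expands X H Y c m a.
Proof.
move=> [cP ->] nm; split=> [i j /cP /and3P[-> ? ?]|].
  by apply/andP; split; lia.
rewrite (big_ord_widen m (fun i => \sum_(j < n) c i j *: Z X H Y i j)) //.
rewrite big_mkcond; apply: eq_bigr => i _; case: ltnP => hi; last first.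
  rewrite big1 // => j _; case: (eqVneq (c i j) 0) => [->|/cP]; rewrite ?scale0r //.
  by case/and3P; lia.
rewrite (big_ord_widen m (fun j => c i j *: Z X H Y i j)) // big_mkcond.
apply: eq_bigr => j _; case: ltnP => hj //.
case: (eqVneq (c i j) 0) => [->|/cP]; rewrite ?scale0r //.
by case/and3P; lia.
Qed.

Lemma expandsD X H Y c d n a b : expands X H Y c n a -> expands X H Y d n b ->
  expands X H Y (fun i j => c i j + d i j) n (a + b).
Proof.
move=> [cP ->] [dP ->]; split=> [i j|].
  case: (eqVneq (c i j) 0) => [->|/cP //]; by rewrite add0r => /dP.
rewrite -big_split; apply: eq_bigr => i _; rewrite -big_split.
by apply: eq_bigr => j _; rewrite /= scalerDl.
Qed.

Lemma expandsZ X H Y c k n a : expands X H Y c n a ->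
  expands X H Y (fun i j => k * c i j) n (k *: a).
Proof.
move=> [cP ->]; split=> [i j|].
  by rewrite mulf_eq0 negb_or => /andP[_ /cP].
rewrite scaler_sumr; apply: eq_bigr => i _; rewrite scaler_sumr.
by apply: eq_bigr => j _; rewrite scalerA.
Qed.

Definition expandable X H Y a := exists c n, expands X H Y c n a.

Lemma expandableD X H Y a b : expandable X H Y a -> expandable X H Y b ->
  expandable X H Y (a + b).
Proof.
move=> [c [n ha]] [d [m hb]]; exists (fun i j => c i j + d i j), (maxn n m).
by apply: expandsD; [apply: expandsW ha _|apply: expandsW hb _]; lia.
Qed.

Lemma expandableZ X H Y k a : expandable X H Y a -> expandable X H Y (k *: a).
Proof. by move=> [c [n ha]]; exists (fun i j => k * c i j), n; apply: expandsZ. Qed.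

Lemma expands0 X H Y : expands X H Y (fun _ _ => 0) 0 0.
Proof. by split=> [i j|]; rewrite ?eqxx // big_ord0. Qed.

Lemma expandable_sum X H Y (I : finType) (P : pred I) (F : I -> A) :
  (forall i, P i -> expandable X H Y (F i)) ->
  expandable X H Y (\sum_(i | P i) F i).
Proof.
move=> h; elim/big_ind: _ => [|a b|//]; last exact: expandableD.
by exists (fun _ _ => 0), 0%N; apply: expands0.
Qed.

Lemma expandable_Z X H Y i j : ~~ odd (i + j) -> expandable X H Y (Z X H Y i j).
Proof.
move=> ev; pose n := (maxn i j).+1.
have hi : (i < n)%N by rewrite /n; lia.
have hj : (j < n)%N by rewrite /n; lia.
exists (fun i' j' => ((i' == i) && (j' == j))%:R), n; split=> [i' j'|].
  by case: (eqVneq i' i) => [->|_]; case: (eqVneq j' j) => [->|_] /=;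
    rewrite ?eqxx // ev hi hj.
rewrite (bigD1 (Ordinal hi)) //= [X in _ + X]big1 ?addr0; last first.
  move=> k /eqP ki; rewrite big1 // => l _.
  case: eqP => [e|_]; last by rewrite scale0r.
  by case: ki; apply: val_inj.
rewrite (bigD1 (Ordinal hj)) //= [X in _ + X]big1 ?addr0 ?eqxx ?scale1r //.
move=> k /eqP ki; case: eqP => [e|_]; last by rewrite scale0r.
by case: ki; apply: val_inj.
Qed.

Lemma Z_mulH X H Y i j : Z X H Y i j * H = Z X H Y i.+1 j.+1.
Proof. by rewrite /Z ltnS !subSS; case: leqP => _; rewrite -mulrA -exprSr. Qed.

End Monomials.

Section Expansion.
Variables (K : numFieldType) (lam : K) (A : algType K) (X H Y : A).
Hypothesis AP : presents lam X H Y.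
Let rel := AP.1.

Lemma ad_H_Z i j : ~~ odd (i + j) ->
  br H (Z X H Y i j) = (i%:R - j%:R) *: Z X H Y i j.
Proof.
move=> ev; rewrite /br /Z; case: leqP => ij.
  rewrite mulrA (rel_HXn rel) mulrDl -!mulrA -exprS -exprSr addrC addKr -scalerAl.
  by congr (_ *: _); rewrite -natrB //; congr (_%:R); lia.
rewrite mulrA (rel_HYn rel) mulrBl -!mulrA -exprS -exprSr addrC addKr -scalerAl -scaleNr.
by congr (_ *: _); rewrite -opprB -natrB 1?ltnW //; congr (- _%:R); lia.
Qed.

Lemma H_mulZ i j : ~~ odd (i + j) ->
  H * Z X H Y i j = Z X H Y i.+1 j.+1 + (i%:R - j%:R) *: Z X H Y i j.
Proof. by move=> ev; rewrite -ad_H_Z // -Z_mulH /br addrC subrK. Qed.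

Lemma expandable_mul_closed x :
  (forall i j, ~~ odd (i + j) -> expandable X H Y (x * Z X H Y i j)) ->
  forall a, expandable X H Y a -> expandable X H Y (x * a).
Proof.
move=> h a [c [n [cP ->]]]; rewrite mulr_sumr; apply: expandable_sum => i _.
rewrite mulr_sumr; apply: expandable_sum => j _; rewrite -scalerAr.
case: (eqVneq (c i j) 0) => [->|/cP /and3P[ev _ _]].
  by rewrite scale0r; exists (fun _ _ => 0), 0%N; apply: expands0.
exact/expandableZ/h.
Qed.

Lemma expandable_mulH a : expandable X H Y a -> expandable X H Y (H * a).
Proof.
apply: expandable_mul_closed => i j ev; rewrite H_mulZ //.
by apply: expandableD; [|apply: expandableZ]; apply: expandable_Z => //; lia.
Qed.

Lemma expandable_quad x y z a : expandable X H Y a ->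
  expandable X H Y ((x *: 1 - y *: H - z *: (H * H)) * a).
Proof.
move=> ha; rewrite !mulrBl -!scalerAl mul1r -mulrA -!scaleNr.
by repeat apply: expandableD; apply: expandableZ; do ?apply: expandable_mulH.
Qed.

Lemma expandable_mulX a : expandable X H Y a -> expandable X H Y (X * a).
Proof.
apply: expandable_mul_closed => i j ev; have [ji|ij] := leqP j i.
  have -> : X * Z X H Y i j = Z X H Y i.+2 j.
    rewrite /Z ji ifT; last by lia.
    by rewrite mulrA -exprS; congr (X ^+ _ * _); lia.
  by apply: expandable_Z; lia.
have [k ek] : exists k, (j = i + k.+1.*2)%N.
  by exists ((j - i)./2.-1); lia.
(* Peeling off one Y leaves X Y, which the Casimir relation turns into a quadratic polynomial in
   H. *)
have -> : X * Z X H Y i j = (X * Y) * Z X H Y i (i + k.*2).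
  have -> : Z X H Y i j = Y ^+ k.+1 * H ^+ i.
    by rewrite /Z leqNgt ij /=; congr (Y ^+ _ * _); lia.
  have -> : Z X H Y i (i + k.*2) = Y ^+ k * H ^+ i.
    rewrite /Z; case: leqP => hk; last by rewrite addKn doubleK.
    have -> : k = 0%N by lia.
    by rewrite double0 addn0 subnn.
  by rewrite exprS !mulrA.
rewrite (rel_XY rel) mulrDl (rel_YX rel).
apply: expandableD; [apply: expandable_quad|apply: expandable_mulH];
  by apply: expandable_Z; lia.
Qed.

Lemma expandable_mulY a : expandable X H Y a -> expandable X H Y (Y * a).
Proof.
apply: expandable_mul_closed => i j ev; have [ij|ji] := leqP i j.
  have -> : Y * Z X H Y i j = Z X H Y i j.+2.
    rewrite /Z [(j.+2 <= i)%N]leqNgt ltnS ?(leqW ij) //=.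
    case: leqP => ji; last by rewrite mulrA -exprS; congr (Y ^+ _ * _); lia.
    have -> : j = i by lia.
    by rewrite subnn -addn2 addKn mul1r expr1.
  by apply: expandable_Z; lia.
have [k ek] : exists k, (i = j + k.+1.*2)%N.
  by exists ((i - j)./2.-1); lia.
have -> : Y * Z X H Y i j = (Y * X) * Z X H Y (j + k.*2) j.
  rewrite /Z ek !leq_addr !addKn !doubleK exprS !mulrA //.
rewrite (rel_YX rel).
by apply: expandable_quad; apply: expandable_Z; lia.
Qed.

Lemma expandableT a : expandable X H Y a.
Proof.
apply: (presents_ind AP) a => [|||||].
- by rewrite -[1]mulr1 -{1}(expr0 X) -(expr0 H); apply: (@expandable_Z _ _ X H Y 0 0).
- exact: expandableD.
- exact: expandableZ.
- exact: expandable_mulX.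
- exact: expandable_mulH.
- exact: expandable_mulY.
Qed.

End Expansion.

(* g n is the top form of (ad h)^n applied to a generator, F that of h: gS is the Poisson
   bracket with F in the coordinate b / a, where M n is the weight of g n. *)
Section SymbolIteration.
Variables (K : numFieldType) (F : {poly K}) (g : nat -> {poly K}).
Variables (u N : nat) (M : nat -> nat).
Hypothesis u_gt0 : (0 < u)%N.
Hypothesis gS : forall n,
  u%:R * g n.+1 = N%:R * F * (g n)^`() - (M n)%:R * F^`() * g n.

Let u_neq0 : u%:R != 0 :> K. Proof. by rewrite pnatr_eq0 -lt0n. Qed.

(** At a root x of multiplicity k + 1 the form [g n] vanishes to order exactly n k: each step adds k
    to the order, and the leading coefficient is multiplied, up to nonzero factors, by N n k - (M
    n)(k + 1), which is nonzero by hypothesis. *)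
Lemma iter_root_neq0 (x : K) k (F1 : {poly K}) :
  F = F1 * ('X - x%:P) ^+ k.+1 -> F1.[x] != 0 -> (g 0).[x] != 0 ->
  (forall n, N * (n * k) < M n * k.+1)%N ->
  forall n, g n != 0.
Proof.
move=> FE F1x g0x hM; pose L : {poly K} := 'X - x%:P.
suff main n : exists2 r : {poly K}, g n = r * L ^+ (n * k) & r.[x] != 0.
  move=> n; have [r -> rx] := main n; apply/eqP => /eqP.
  rewrite mulf_eq0 expf_eq0 polyXsubC_eq0 andbF orbF => /eqP r0.
  by rewrite r0 horner0 eqxx in rx.
have dL j : L * (L ^+ j)^`() = j%:R * L ^+ j.
  rewrite deriv_exp derivXsubC mul1r -mulr_natl mulrCA.
  by case: j => [|j]; rewrite ?mul0r //= -exprS.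
have dLS j : (L ^+ j.+1)^`() = j.+1%:R * L ^+ j.
  by rewrite deriv_exp derivXsubC mul1r -mulr_natl.
elim: n => [|n [r gE rx]]; first by exists (g 0); rewrite ?mul0n ?expr0 ?mulr1.
set l := (n * k)%N in gE *.
pose t := N%:R * F1 * (L * r^`() + l%:R * r)
  - (M n)%:R * (F1^`() * L + k.+1%:R * F1) * r.
have E : u%:R * g n.+1 = t * L ^+ (n.+1 * k).
  rewrite gS gE FE -/L !derivM dLS mulSn exprD.
  have -> : N%:R * (F1 * L ^+ k.+1) * (r^`() * L ^+ l + r * (L ^+ l)^`())
    = N%:R * (F1 * L ^+ k) * (L * r^`() * L ^+ l + r * (L * (L ^+ l)^`())).
    rewrite exprS; ring.
  rewrite dL -/l /t exprS; ring.
exists ((u%:R^-1)%:P * t).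
  rewrite -mulrA -E mulrA -(rmorph_nat polyC) -polyCM mulVf // mul1r //.
rewrite hornerM hornerC mulf_neq0 ?invr_eq0 //.
have -> : t.[x] = - ((M n * k.+1)%:R - (N * l)%:R) * F1.[x] * r.[x].
  have hn j : (j%:R : {poly K}).[x] = j%:R by rewrite -(rmorph_nat polyC) hornerC.
  rewrite !natrM /t !hornerD !hornerN !hornerM !hornerD !hornerM !hn.
  rewrite /L hornerXsubC /l natrM; ring.
rewrite !mulf_neq0 // oppr_eq0 -natrB ?(ltnW (hM n)) // pnatr_eq0 subn_eq0 -ltnNge.
exact: hM.
Qed.

(** The same argument at infinity: each step adds J to the degree, and the leading coefficient is
    multiplied, up to nonzero factors, by N deg (g n) - (M n) deg F. *)
Lemma iter_degree_neq0 J d :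
  size F = J.+2 -> size (g 0) = d.+2 ->
  (forall n, (M n * J.+1 != N * (d.+1 + n * J)))%N ->
  forall n, g n != 0.
Proof.
move=> sF sg hM n; suff : size (g n) = (d + n * J).+2.
  by move=> s; rewrite -size_poly_eq0 s.
elim: n => [|n IH]; first by rewrite sg mul0n addn0.
have lF : F`_J.+1 != 0 by rewrite -[J.+1]/(J.+2.-1) -sF -lead_coefE lead_coef_eq0 -size_poly_eq0 sF.
set D := (d + n * J)%N in IH *.
have lg : (g n)`_D.+1 != 0 by rewrite -[D.+1]/(D.+2.-1) -IH -lead_coefE lead_coef_eq0 -size_poly_eq0 IH.
have sdF : (size F^`() <= J.+1)%N by rewrite -ltnS -sF lt_size_deriv // -size_poly_eq0 sF.
have sdg : (size (g n)^`() <= D.+1)%N by rewrite -ltnS -IH lt_size_deriv // -size_poly_eq0 IH.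
have E : size (u%:R * g n.+1) = size (g n.+1).
  by rewrite -(rmorph_nat polyC) size_Cmul.
rewrite -E gS; apply/eqP; rewrite eqn_leq; apply/andP; split.
  apply: leq_trans (size_polyD _ _) _; rewrite size_polyN geq_max -!mulrA.
  rewrite -!(rmorph_nat polyC); apply/andP; split.
    rewrite mul_polyC (leq_trans (size_scale_leq _ _)) //.
    apply: leq_trans (@size_mul_bound _ _ _ J.+1 D _ _) _; rewrite ?sF //; lia.
  rewrite mul_polyC (leq_trans (size_scale_leq _ _)) //.
  apply: leq_trans (@size_mul_bound _ _ _ J D.+1 _ _) _; rewrite ?IH //; lia.
have -> : (d + n.+1 * J = J + D)%N by rewrite /D; lia.
rewrite ltnNge; apply/negP => /leq_sizeP/(_ (J.+1 + D)%N).
rewrite coefB -!mulrA -!(rmorph_nat polyC) !coefCM.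
rewrite (@coef_mul_top _ _ _ J.+1 D) ?sF // addSnnS.
rewrite (@coef_mul_top _ _ _ J D.+1) ?IH // !coef_deriv.
rewrite addnS => /(_ (leqnn _)).
have -> : N%:R * (F`_J.+1 * ((g n)`_D.+1 *+ D.+1)) - (M n)%:R * (F`_J.+1 *+ J.+1 * (g n)`_D.+1)
  = ((N * D.+1)%:R - (M n * J.+1)%:R) * F`_J.+1 * (g n)`_D.+1.
  rewrite !natrM -[_ *+ D.+1]mulr_natl -[_ *+ J.+1]mulr_natl; ring.
apply/eqP; rewrite !mulf_neq0 // subr_eq0 eqr_nat eq_sym; exact: hM.
Qed.

End SymbolIteration.

(** * Top forms of monomials and linear independence *)

Section MonomialSymbols.
Variables (K : numFieldType) (lam : K) (A : algType K) (X0 H0 Y0 : A).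
Variable s : A -> {poly {poly K}}.
Hypothesis sP : is_symbol lam X0 H0 Y0 s.
Variables (p q : nat).
Hypotheses (q_gt0 : (0 < q)%N) (qp : (q <= p)%N).
Local Notation wle := (wle s p q).
Local Notation tp := (tp s p q).

Definition kap i j : K :=
  if (j <= i)%N then (- 2%:R) ^+ j else (- 1) ^+ (j - i)./2 * (- 2%:R) ^+ i.

Lemma kap_neq0 i j : kap i j != 0.
Proof.
have n2 : - 2%:R != 0 :> K by rewrite oppr_eq0 pnatr_eq0.
have n1 : - 1 != 0 :> K by rewrite oppr_eq0 oner_eq0.
by rewrite /kap; case: leqP => _; rewrite ?mulf_neq0 // expf_neq0.
Qed.

Variables (X H Y : A) (L : {poly K}).
Hypotheses (wX : wle (2 * q) X) (wH : wle (p + q) H) (wY : wle (2 * p) Y).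
Hypotheses (tX : tp (2 * q) X = 1) (tH : tp (p + q) H = - 2%:R * L).
Hypothesis (tY : tp (2 * p) Y = - L ^+ 2).

(** The triple need not be the one that defines [s]: L represents b/a, which is 'X for the defining
    triple and a translate of it for a sheared one. *)
Lemma Z_symbol i j : ~~ odd (i + j) ->
  wle (i * q + j * p) (Z X H Y i j) /\
  tp (i * q + j * p) (Z X H Y i j) = (kap i j)%:P * L ^+ j.
Proof.
move=> ev.
have t2 : - 2%:R * L = (- 2%:R)%:P * L :> {poly K}.
  by rewrite polyCN rmorph_nat.
rewrite /Z /kap; case: leqP => ij.
  have [w1 t1] := wleX_tp sP q_gt0 qp (i - j)./2 wX.
  have [w3 t3] := wleX_tp sP q_gt0 qp j wH.
  have -> : (i * q + j * p = (i - j)./2 * (2 * q) + j * (p + q))%N.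
    have e : i = (j + (i - j)./2 * 2)%N by lia.
    by rewrite {1}e; move: (_./2) => k; nia.
  split; first exact: (wleM sP q_gt0 qp).
  by rewrite (tpM sP q_gt0 qp) // t1 t3 tX tH expr1n mul1r t2 exprMn polyC_exp.
have [w1 t1] := wleX_tp sP q_gt0 qp (j - i)./2 wY.
have [w3 t3] := wleX_tp sP q_gt0 qp i wH.
have -> : (i * q + j * p = (j - i)./2 * (2 * p) + i * (p + q))%N.
  have e : j = (i + (j - i)./2 * 2)%N by lia.
  by rewrite {1}e; move: (_./2) => k; nia.
split; first exact: (wleM sP q_gt0 qp).
have tY1 : - L ^+ 2 = (- 1)%:P * L ^+ 2 by rewrite polyCN polyC1 mulN1r.
rewrite (tpM sP q_gt0 qp) // t1 t3 tY tH t2 tY1 exprMn [(_ * L) ^+ i]exprMn -exprM -!polyC_exp.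
have -> : L ^+ j = L ^+ (2 * (j - i)./2) * L ^+ i.
  by rewrite -exprD; congr (L ^+ _); lia.
by rewrite polyCM mulrACA.
Qed.

Variables (c : nat -> nat -> K) (n : nat) (a : A) (N : nat).
Hypothesis aE : expands X H Y c n a.
Hypothesis cN : forall i j, c i j != 0 -> (i * q + j * p <= N)%N.

Lemma expands_wle_gen : wle N a.
Proof.
case: aE => cP ->; apply: (wle_sum sP) => i _.
apply: (wle_sum sP) => j _.
have [->|c0] := eqVneq (c i j) 0; first by rewrite scale0r; apply: (wle0 sP).
have /and3P[ev _ _] := cP _ _ c0.
exact: (wleZ sP) (wleW (Z_symbol ev).1 (cN c0)).
Qed.

Lemma expands_tp_gen : tp N a = \sum_(i < n) \sum_(j < n | (i * q + j * p == N)%N)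
  (c i j * kap i j)%:P * L ^+ j.
Proof.
case: aE => cP ->; rewrite (tp_sum sP); apply: eq_bigr => i _.
rewrite (tp_sum sP) [RHS]big_mkcond; apply: eq_bigr => j _.
have [->|c0] := eqVneq (c i j) 0.
  by rewrite scale0r mul0r polyC0 mul0r if_same (tp0 sP).
have /and3P[ev _ _] := cP _ _ c0; rewrite (tpZ sP).
case: eqP => [<-|ne]; first by rewrite (Z_symbol ev).2 mulrA -polyCM.
rewrite (wle_tp0 (Z_symbol ev).1) ?mulr0 // ltn_neqAle (cN c0) andbT.
exact/eqP.
Qed.

End MonomialSymbols.

Section FrameSymbols.
Variables (K : numFieldType) (lam : K) (A : algType K) (X H Y : A).
Variable s : A -> {poly {poly K}}.
Hypothesis sP : is_symbol lam X H Y s.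
Variables (p q : nat).
Hypotheses (q_gt0 : (0 < q)%N) (qp : (q <= p)%N).
Local Notation wle := (wle s p q).
Local Notation tp := (tp s p q).
Local Notation kap := (kap K).

Section Expanded.
Variables (c : nat -> nat -> K) (n : nat) (a : A) (N : nat).
Hypothesis aE : expands X H Y c n a.
Hypothesis cN : forall i j, c i j != 0 -> (i * q + j * p <= N)%N.

Lemma expands_wle : wle N a.
Proof.
have [wX wH wY] := wle_gens sP q_gt0 qp; have [tX tH tY] := tp_gens sP q_gt0 qp.
exact: (expands_wle_gen sP q_gt0 qp wX wH wY tX tH tY aE cN).
Qed.

Lemma expands_tp : tp N a = \sum_(i < n) \sum_(j < n | (i * q + j * p == N)%N)
  (c i j * kap i j)%:P * 'X^j.
Proof.
have [wX wH wY] := wle_gens sP q_gt0 qp; have [tX tH tY] := tp_gens sP q_gt0 qp.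
exact: (expands_tp_gen sP q_gt0 qp wX wH wY tX tH tY aE cN).
Qed.

(** As q > 0, the weight N and j determine i: distinct monomials of one weight have distinct powers
    of b, so they cannot cancel at a = 1. *)
Lemma coef_expands_tp i j : (i * q + j * p = N)%N -> (tp N a)`_j = c i j * kap i j.
Proof.
move=> ijN; rewrite expands_tp coef_sum.
have c0 i' j' : (i' < n)%N = false \/ (j' < n)%N = false -> c i' j' = 0.
  move=> h; apply/eqP; apply: contraT => /(aE.1) /and3P[_ hi hj].
  by case: h; lia.
have [hi|hi] := ltnP i n; last first.
  rewrite (c0 i j) ?mul0r; last by left; lia.
  apply: big1 => i' _; rewrite coef_sum big1 // => j' /eqP e.
  rewrite coefCM coefXn; case: eqP => [ejj|]; rewrite ?mulr0 //.
  have : (i' = i :> nat) by nia.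
  by have := ltn_ord i'; lia.
have [hj|hj] := ltnP j n; last first.
  rewrite (c0 i j) ?mul0r; last by right; lia.
  apply: big1 => i' _; rewrite coef_sum big1 // => j' /eqP e.
  rewrite coefCM coefXn; case: eqP => [ejj|]; rewrite ?mulr0 //.
  by have := ltn_ord j'; lia.
rewrite (bigD1 (Ordinal hi)) //= [X in _ + X]big1 ?addr0; last first.
  move=> i' /eqP ne; rewrite coef_sum big1 // => j' /eqP e.
  rewrite coefCM coefXn; case: eqP => [ejj|]; rewrite ?mulr0 //.
  by case: ne; apply: val_inj => /=; nia.
rewrite coef_sum (bigD1 (Ordinal hj)) /=; last by apply/eqP.
rewrite coefCM coefXn eqxx mulr1 big1 ?addr0 // => j' /andP[_ /eqP ne].
rewrite coefCM coefXn; case: eqP => [ejj|]; rewrite ?mulr0 //.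
by case: ne; apply: val_inj.
Qed.

Lemma coef_expands_tp_neq0 j : (tp N a)`_j != 0 ->
  exists2 i, (i * q + j * p = N)%N & c i j != 0.
Proof.
move=> h; have : exists i : 'I_n, (i * q + j * p == N)%N.
  apply/existsP; apply: contraNT h; rewrite negb_exists => /forallP h.
  rewrite expands_tp coef_sum big1 // => i _; rewrite coef_sum big1 // => j' e.
  rewrite coefCM coefXn; case: eqP => [ejj|]; rewrite ?mulr0 //.
  by have := h i; rewrite ejj e.
case=> i /eqP e; exists (i : nat) => //.
by move: h; rewrite (coef_expands_tp e); apply: contraNneq => ->; rewrite mul0r.
Qed.

End Expanded.

Lemma expands_max c n a : expands X H Y c n a -> a != 0 ->
  exists N, (forall i j, c i j != 0 -> (i * q + j * p <= N)%N) /\ tp N a != 0.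
Proof.
move=> aE a0; pose P N := [exists i : 'I_n, exists j : 'I_n,
  (c i j != 0) && (i * q + j * p == N)%N].
have PE i j : c i j != 0 -> P (i * q + j * p)%N.
  move=> h; have /and3P[_ hi hj] := aE.1 _ _ h.
  by apply/existsP; exists (Ordinal hi); apply/existsP; exists (Ordinal hj); rewrite /= h eqxx.
have ex : exists N, P N.
  case: (boolP [exists i : 'I_n, exists j : 'I_n, c i j != 0]).
    by case/existsP=> i /existsP[j h]; exists (i * q + j * p)%N; apply: PE.
  rewrite negb_exists => /forallP h; case/eqP: a0; rewrite aE.2.
  rewrite big1 // => i _; rewrite big1 // => j _.
  by have := h i; rewrite negb_exists => /forallP/(_ j); rewrite negbK => /eqP ->; rewrite scale0r.
have ub N : P N -> (N <= n * q + n * p)%N.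
  case/existsP=> i /existsP[j /andP[_ /eqP <-]].
  by apply: leq_add; rewrite leq_mul2r ltnW ?orbT.
case: (ex_maxnP ex ub) => N /existsP[i /existsP[j /andP[cij /eqP ijN]]] Nmax.
have cN i' j' : c i' j' != 0 -> (i' * q + j' * p <= N)%N by move=> /PE /Nmax.
exists N; split=> //; apply: contraNneq cij => t0.
have := coef_expands_tp aE cN ijN; rewrite t0 coef0 => /esym/eqP.
by rewrite mulf_eq0 (negPf (kap_neq0 _ _ _)) orbF => /eqP ->.
Qed.

Lemma expands_wleP c n a N : expands X H Y c n a -> wle N a ->
  forall i j, c i j != 0 -> (i * q + j * p <= N)%N.
Proof.
move=> aE ha i j cij; have [a0|a0] := eqVneq a 0; last first.
  have [N' [cN' tN']] := expands_max aE a0.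
  apply: leq_trans (cN' _ _ cij) _; rewrite leqNgt; apply: contra tN' => h.
  by rewrite (wle_tp0 ha h).
have ub i' j' : c i' j' != 0 -> (i' * q + j' * p <= n * q + n * p)%N.
  by case/(aE.1)/and3P=> _ hi hj; apply: leq_add; rewrite leq_mul2r ltnW ?orbT.
(* For a = 0 any bound M can be lowered, because the top form at M is zero; this is the linear
   independence of the monomials. *)
suff : forall M, (forall i' j', c i' j' != 0 -> (i' * q + j' * p <= M)%N) -> c i j = 0.
  by move=> /(_ _ ub) e; rewrite e eqxx in cij.
elim=> [|M IH] cM.
  have e : (i * q + j * p = 0)%N by have := cM _ _ cij; lia.
  have := coef_expands_tp aE cM e; rewrite a0 (tp0 sP) coef0 => /esym/eqP.
  by rewrite mulf_eq0 (negPf (kap_neq0 _ _ _)) orbF => /eqP ->.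
apply: IH => i' j' c'; have := cM _ _ c'; rewrite leq_eqVlt => /orP[/eqP e|//].
have := coef_expands_tp aE cM e; rewrite a0 (tp0 sP) coef0 => /esym/eqP.
by rewrite mulf_eq0 (negPf (kap_neq0 _ _ _)) orbF => /eqP h; rewrite h eqxx in c'.
Qed.

End FrameSymbols.

(** * Comparing linear combinations coefficient by coefficient *)

Section LinearCombinations.
Variables (K : pzRingType) (V : lmodType K).

Inductive lexp :=
  | LVar of nat | LZero | LAdd of lexp & lexp | LOpp of lexp | LScale of K & lexp.

Fixpoint leval (vs : seq V) (e : lexp) : V :=
  match e with
  | LVar i => vs`_i
  | LZero => 0
  | LAdd e1 e2 => leval vs e1 + leval vs e2
  | LOpp e1 => - leval vs e1
  | LScale k e1 => k *: leval vs e1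
  end.

Fixpoint lcoef (e : lexp) (i : nat) : K :=
  match e with
  | LVar j => if j == i then 1 else 0
  | LZero => 0
  | LAdd e1 e2 => lcoef e1 i + lcoef e2 i
  | LOpp e1 => - lcoef e1 i
  | LScale k e1 => k * lcoef e1 i
  end.

Lemma leval_lcoef vs e : leval vs e = \sum_(i < size vs) lcoef e i *: vs`_i.
Proof.
elim: e => [j||e1 IH1 e2 IH2|e IH|k e IH] /=.
- have [hj|hj] := ltnP j (size vs); last first.
    rewrite nth_default // big1 // => i _; case: eqP => [e|_]; last by rewrite scale0r.
    by have := ltn_ord i; rewrite -e ltnNge hj.
  rewrite (bigD1 (Ordinal hj)) //= eqxx scale1r big1 ?addr0 // => i.
  by rewrite -val_eqE /= eq_sym => /negPf ->; rewrite scale0r.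
- by rewrite big1 // => i _; rewrite scale0r.
- by rewrite IH1 IH2 -big_split; apply: eq_bigr => i _; rewrite scalerDl.
- by rewrite IH -sumrN; apply: eq_bigr => i _; rewrite scaleNr.
- by rewrite IH scaler_sumr; apply: eq_bigr => i _; rewrite scalerA.
Qed.

Fixpoint coefs_eq (e1 e2 : lexp) n : Prop :=
  if n is n'.+1 then lcoef e1 n' = lcoef e2 n' /\ coefs_eq e1 e2 n' else True.

Lemma leval_eq vs e1 e2 : coefs_eq e1 e2 (size vs) -> leval vs e1 = leval vs e2.
Proof.
move=> h; rewrite !leval_lcoef; apply: eq_bigr => i _; congr (_ *: _).
case: i => i /= hi; elim: (size vs) hi h => // n IH; rewrite ltnS leq_eqVlt.
by case/orP=> [/eqP -> []|hi [_ /(IH hi)]].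
Qed.

End LinearCombinations.

Ltac lc_index x vs :=
  match vs with
  | ?y :: _ => let e := constr:(erefl : x = y) in constr:(0%N)
  | _ :: ?r => let i := lc_index x r in constr:(S i)
  end.
Ltac lc_atoms t vs :=
  lazymatch t with
  | (?a + ?b)%R => let vs1 := lc_atoms a vs in lc_atoms b vs1
  | (- ?a)%R => lc_atoms a vs
  | (_ *: ?a)%R => lc_atoms a vs
  | 0%R => vs
  | _ => match vs with
         | _ => let i := lc_index t vs in vs
         | _ => constr:(t :: vs)
         end
  end.
Ltac lc_reify K t vs :=
  lazymatch t with
  | (?a + ?b)%R => let x := lc_reify K a vs in let y := lc_reify K b vs in
                 constr:(@LAdd K x y)
  | (- ?a)%R => let x := lc_reify K a vs in constr:(@LOpp K x)
  | (?k *: ?a)%R => let x := lc_reify K a vs in constr:(@LScale K k x)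
  | 0%R => constr:(@LZero K)
  | _ => let i := lc_index t vs in constr:(@LVar K i)
  end.
(* Reduces an equality of linear combinations in a [K]-module to the equalities of the
   coefficients of the atoms. *)
Ltac lincomb K :=
  lazymatch goal with
  | |- @eq ?T ?l ?r =>
    let vs0 := lc_atoms l (@nil T) in
    let vs := lc_atoms r vs0 in
    let e1 := lc_reify K l vs in
    let e2 := lc_reify K r vs in
    refine (@leval_eq K _ vs e1 e2 _); rewrite /coefs_eq /lcoef /=;
    repeat first [exact I | split; [try ring|]]
  end.

(** * Changes of presentation: swap, torus, shears *)

Section ChangeOfPresentation.
Variables (K : numFieldType) (lam : K).
Local Notation op3 := (forall B : algType K, B -> B -> B -> B).

(** A noncommutative polynomial in three generators is encoded as a family of operations natural in
    the algebra. If two such substitutions are mutually inverse and preserve the relations, the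
    universal property passes along them. *)
Lemma presents_change (t1 t2 t3 s1 s2 s3 : op3) :
  let nat_op (t : op3) := forall (A B : algType K) (f : A -> B), alg_hom f ->
    forall x h y, f (t A x h y) = t B (f x) (f h) (f y) in
  [/\ nat_op t1, nat_op t2 & nat_op t3] -> [/\ nat_op s1, nat_op s2 & nat_op s3] ->
  (forall (B : algType K) (x h y : B), sl2_rel lam x h y ->
     let x' := t1 B x h y in let h' := t2 B x h y in let y' := t3 B x h y in
     [/\ sl2_rel lam x' h' y', s1 B x' h' y' = x, s2 B x' h' y' = h
       & s3 B x' h' y' = y]) ->
  (forall (B : algType K) (x h y : B), sl2_rel lam x h y ->
     let x' := s1 B x h y in let h' := s2 B x h y in let y' := s3 B x h y in
     [/\ sl2_rel lam x' h' y', t1 B x' h' y' = x, t2 B x' h' y' = h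
       & t3 B x' h' y' = y]) ->
  forall (A : algType K) (X H Y : A), presents lam X H Y ->
    presents lam (t1 A X H Y) (t2 A X H Y) (t3 A X H Y).
Proof.
move=> nat_op [n1 n2 n3] [m1 m2 m3] ts st A X H Y [rel univ]; split.
  by case: (ts _ _ _ _ rel).
move=> B x h y relB; have [relB' e1 e2 e3] := st _ _ _ _ relB.
have [f [fP fX fH fY fU]] := univ _ _ _ _ relB'; exists f; split=> //.
- by rewrite n1 // fX fH fY.
- by rewrite n2 // fX fH fY.
- by rewrite n3 // fX fH fY.
move=> g gP gX gH gY; have [_ d1 d2 d3] := ts _ _ _ _ rel.
apply: fU => //.
- by rewrite -d1 m1 // gX gH gY.
- by rewrite -d2 m2 // gX gH gY.
- by rewrite -d3 m3 // gX gH gY.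
Qed.

Lemma presents_swap (A : algType K) (X H Y : A) :
  presents lam X H Y -> presents lam Y (- H) X.
Proof.
have natN (A1 B : algType K) (f : A1 -> B) : alg_hom f -> forall a, f (- a) = - f a.
  by move=> [_ fZ _ _] a; rewrite -scaleN1r fZ scaleN1r.
have sw (B : algType K) (x h y : B) : sl2_rel lam x h y -> sl2_rel lam y (- h) x.
  move=> rel; have [r1 r2 r3 r4] := rel; split.
  - by rewrite -opprB r1.
  - by rewrite mulNr mulrN opprK addrC -opprB r3 opprK.
  - by rewrite mulNr mulrN opprK addrC -opprB r2.
  - rewrite (rel_XY rel) sqrrN -[RHS]r4; lincomb K.
exact: (@presents_change (fun B x h y => y) (fun B x h y => - h) (fun B x h y => x)
  (fun B x h y => y) (fun B x h y => - h) (fun B x h y => x)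
  (And3 (fun _ _ _ _ _ _ _ => erefl) (fun _ _ _ fP _ _ _ => natN _ _ _ fP _)
    (fun _ _ _ _ _ _ _ => erefl))
  (And3 (fun _ _ _ _ _ _ _ => erefl) (fun _ _ _ fP _ _ _ => natN _ _ _ fP _)
    (fun _ _ _ _ _ _ _ => erefl))
  (fun B x h y r => And4 (sw B x h y r) erefl (opprK _) erefl)
  (fun B x h y r => And4 (sw B x h y r) erefl (opprK _) erefl)).
Qed.

Lemma presents_torus (k : K) (A : algType K) (X H Y : A) : k != 0 ->
  presents lam X H Y -> presents lam (k *: X) H (k^-1 *: Y).
Proof.
move=> k0; have natZ c (A1 B : algType K) (f : A1 -> B) :
    alg_hom f -> forall a, f (c *: a) = c *: f a by move=> [_ fZ _ _] a.
have sw c (B : algType K) (x h y : B) : c != 0 ->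
    sl2_rel lam x h y -> sl2_rel lam (c *: x) h (c^-1 *: y).
  move=> c0 [r1 r2 r3 r4]; split.
  - by rewrite -!scalerAl -!scalerAr !scalerA mulfV // mulVf // !scale1r.
  - by rewrite -scalerAl -scalerAr -scalerBr r2 !scalerA mulrC.
  - by rewrite -scalerAl -scalerAr -scalerBr r3 scalerN !scalerA mulrC.
  - by rewrite -scalerAl -scalerAr !scalerA -mulrA mulVf // mulr1.
have KK (B : algType K) (x : B) : k^-1 *: (k *: x) = x by rewrite scalerA mulVf ?scale1r.
have KV (B : algType K) (x : B) : k *: (k^-1 *: x) = x by rewrite scalerA mulfV ?scale1r.
apply: (@presents_change (fun B x h y => k *: x) (fun B x h y => h)
  (fun B x h y => k^-1 *: y)
  (fun B x h y => k^-1 *: x) (fun B x h y => h) (fun B x h y => k *: y)).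
- by split=> // A1 B f fP x h y; apply: natZ.
- by split=> // A1 B f fP x h y; apply: natZ.
- by move=> B x h y r /=; split; [exact: sw|exact: KK| |exact: KV].
- move=> B x h y r /=; split; [|exact: KV| |exact: KK] => //.
  by have := @sw k^-1 B x h y; rewrite invrK; apply; rewrite ?invr_eq0.
Qed.

(** The image of H under exp(ad((t/(k+1)) X^(k+1))), normalised so that on top forms it is b -> b +
    t a^(2k+1). [shearY] is the image of Y, whose exponential series stops at order two. *)
Definition shearH (t : K) k (B : algType K) (X H : B) := H - (2%:R * t) *: X ^+ k.+1.
Definition shearY (t : K) k (B : algType K) (X H Y : B) :=
  Y + t *: (X ^+ k * H) + (t * k%:R) *: X ^+ k - (t ^+ 2) *: (X ^+ k * X ^+ k.+1).

Lemma rel_XnY (B : algType K) (X H Y : B) k : sl2_rel lam X H Y ->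
  X ^+ k.+1 * Y = Y * X ^+ k.+1 + k.+1%:R *: (X ^+ k * H) + (k * k.+1)%:R *: X ^+ k.
Proof.
move=> rel; elim: k => [|k IH].
  by rewrite !expr1 expr0 mul1r mul0n scale0r addr0 scale1r (rel_XY rel).
rewrite exprS -mulrA IH !mulrDr -!scalerAr !mulrA -!exprS (rel_XY rel).
rewrite !mulrDl -mulrA -exprS (rel_HXn rel) !natrM -[k.+2]addn1 -[k.+1]addn1 !natrD.
lincomb K.
Qed.

Lemma shear_rel t k (B : algType K) (X H Y : B) : sl2_rel lam X H Y ->
  sl2_rel lam X (shearH t k X H) (shearY t k X H Y).
Proof.
move=> rel; have [r1 r2 r3 r4] := rel.
have eHP := rel_HXn rel k; have eHQ := rel_HXn rel k.+1.
have eQY := rel_XnY k rel; have eXY := rel_XY rel; have eHX := rel_HX rel.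
have eHY := rel_HY rel.
have eXP : X * X ^+ k = X ^+ k.+1 by rewrite -exprS.
have ePX : X ^+ k * X = X ^+ k.+1 by rewrite -exprSr.
have eXQ : X ^+ k.+1 * X = X * X ^+ k.+1 by rewrite -exprS -exprSr.
have eQP : X ^+ k.+1 * X ^+ k = X ^+ k * X ^+ k.+1 by rewrite -!exprD addnC.
have k1 : k.+1%:R = k%:R + 1 :> K by rewrite -addn1 natrD.
(* With P and Q opaque, each relation becomes linear in finitely many normally ordered words. *)
rewrite /shearH /shearY; move: eHP eHQ eQY eXP ePX eXQ eQP.
move: (X ^+ k) (X ^+ k.+1) => P Q eHP eHQ eQY eXP ePX eXQ eQP.
rewrite !natrM k1 in eHP eHQ eQY.
have eHXP : P * H * X = Q * H + 2%:R *: Q.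
  by rewrite -mulrA eHX mulrDr -scalerAr mulrA ePX.
have eQXP : P * Q * X = Q * Q by rewrite -mulrA eXQ mulrA ePX.
have ePHQ : P * H * Q = P * Q * H + (2%:R * (k%:R + 1)) *: (P * Q).
  by rewrite -mulrA eHQ mulrDr -scalerAr mulrA.
have eHPH : H * P * H = P * H * H + (2%:R * k%:R) *: (P * H).
  by rewrite eHP mulrDl -scalerAl.
have eHPQ : H * P * Q = P * H * Q + (2%:R * k%:R) *: (P * Q).
  by rewrite eHP mulrDl -scalerAl.
split.
- rewrite !(mulrDr, mulrDl, mulrN, mulNr) -!scalerAl -!scalerAr !mulrA.
  rewrite eXY eHXP eQXP eXP ePX; lincomb K.
- rewrite !(mulrDr, mulrDl, mulrN, mulNr) -!scalerAl -!scalerAr eXQ -r2; lincomb K.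
- rewrite !(mulrDr, mulrDl, mulrN, mulNr) -!scalerAl -!scalerAr !mulrA.
  rewrite eHPH eHPQ eHY eHP eQY eQP ePHQ; lincomb K.
- rewrite expr2 in r4.
  rewrite [(H - _) ^+ 2]expr2 -[RHS]r4 !(mulrDr, mulrDl, mulrN, mulNr) -!scalerAl -!scalerAr.
  by rewrite eHXP eQXP ePX eHQ; lincomb K; field.
Qed.

Lemma presents_shear t k (A : algType K) (X H Y : A) :
  presents lam X H Y -> presents lam X (shearH t k X H) (shearY t k X H Y).
Proof.
have natop c (A1 B : algType K) (f : A1 -> B) : alg_hom f -> forall x h y,
    f (shearH c k x h) = shearH c k (f x) (f h) /\
    f (shearY c k x h y) = shearY c k (f x) (f h) (f y).
  move=> [fD fZ fM f1] x h y.
  have fN a : f (- a) = - f a by rewrite -scaleN1r fZ scaleN1r.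
  have fX a n : f (a ^+ n) = f a ^+ n.
    by elim: n => [|n IH]; rewrite ?expr0 // !exprS fM IH.
  by rewrite /shearH /shearY; split; rewrite !(fD, fN, fZ, fM, fX).
have inv c (B : algType K) (x h y : B) :
    shearH (- c) k x (shearH c k x h) = h /\
    shearY (- c) k x (shearH c k x h) (shearY c k x h y) = y.
  rewrite /shearH /shearY; split; first by lincomb K.
  by rewrite mulrBr -scalerAr; lincomb K.
apply: (@presents_change (fun B x h y => x) (fun B x h y => shearH t k x h)
  (fun B x h y => shearY t k x h y)
  (fun B x h y => x) (fun B x h y => shearH (- t) k x h)
  (fun B x h y => shearY (- t) k x h y)).
- by split=> // A1 B f fP x h y; have [] := natop t _ _ _ fP x h y.
- by split=> // A1 B f fP x h y; have [] := natop (- t) _ _ _ fP x h y.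
- move=> B x h y r /=; have [e1 e2] := inv t B x h y.
  by split=> //; apply: shear_rel.
- move=> B x h y r /=; have [e1 e2] := inv (- t) B x h y.
  by rewrite opprK in e1 e2; split=> //; apply: shear_rel.
Qed.

End ChangeOfPresentation.

Lemma expands_narrow (K : numFieldType) (A : algType K) (X H Y : A) c n m a :
  expands X H Y c n a -> (forall i j, c i j != 0 -> (i < m)%N && (j < m)%N) ->
  expands X H Y c m a.
Proof.
move=> aE cm; have [nm|mn] := leqP n m; first exact: expandsW aE nm.
have mE : expands X H Y c m (\sum_(i < m) \sum_(j < m) c i j *: Z X H Y i j).
  by split=> // i j cij; have /and3P[-> _ _] := aE.1 _ _ cij; exact: cm.
have [_ e] := expandsW mE (ltnW mn).
by rewrite aE.2 -e.
Qed.

Lemma expands_swap (K : numFieldType) (A : algType K) (X H Y : A) c n a :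
  expands X H Y c n a ->
  expands Y (- H) X (fun i j => (- 1) ^+ (minn i j) * c j i) n a.
Proof.
move=> [cP aE]; split=> [i j|].
  rewrite mulf_eq0 negb_or => /andP[_ /cP /and3P[ev hi hj]].
  by rewrite addnC ev hi hj.
rewrite aE exchange_big; apply: eq_bigr => i _; apply: eq_bigr => j _ /=.
have [->|/cP /and3P[ev _ _]] := eqVneq (c j i) 0; first by rewrite mulr0 !scale0r.
have -> : Z Y (- H) X i j = (- 1) ^+ minn i j *: Z X H Y j i.
  have sN m : (- H) ^+ m = (- 1) ^+ m *: H ^+ m by rewrite -scaleN1r exprZn.
  rewrite /Z; case: (ltngtP i j) => [ij|ji|->].
  - by rewrite sN -scalerAr.
  - by rewrite sN -scalerAr.
  - by rewrite sN -scalerAr subnn.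
rewrite scalerA mulrAC -exprMn mulrNN mulr1 expr1n mul1r //.
Qed.

(** * Local finiteness and the Newton polygon *)

Section LocallyFinite.
Variables (K : numFieldType) (A : algType K).

Definition locfin (h : A) : Prop := forall a, exists (I : finType) (b : I -> A),
  forall n, exists k : I -> K, iter n (br h) a = \sum_i k i *: b i.

Lemma locfin_wle (lam : K) (X H Y : A) s p q h a :
  is_symbol lam X H Y s -> locfin h ->
  exists B, forall n, wle s p q B (iter n (br h) a).
Proof.
move=> sP /(_ a) [I [b hb]]; exists (\max_i size (wsym s p q (b i))) => n.
have [k ->] := hb n; apply: (wle_sum sP) => i _; apply: (wleZ sP).
exact: leqW (@leq_bigmax _ (fun i => size (wsym s p q (b i))) i).
Qed.

End LocallyFinite.

Section NewtonPolygon.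
Variables (K : numClosedFieldType) (lam : K) (A : algType K) (h : A).
Hypothesis hfin : locfin h.

Section Frame.
Variables (X H Y : A) (s : A -> {poly {poly K}}).
Hypothesis sP : is_symbol lam X H Y s.
Variables (p q : nat).
Hypotheses (q_gt0 : (0 < q)%N) (qp : (q <= p)%N).
Local Notation wle := (wle s p q).
Local Notation tp := (tp s p q).

Lemma iter_br_tp N M0 a : wle N h -> wle M0 a -> (p + q < N)%N ->
  let M n := (M0 + n * (N - (p + q)))%N in
  forall n, wle (M n) (iter n (br h) a) /\
   (2 * q)%:R * tp (M n.+1) (iter n.+1 (br h) a) =
   N%:R * tp N h * (tp (M n) (iter n (br h) a))^`()
     - (M n)%:R * (tp N h)^`() * tp (M n) (iter n (br h) a).
Proof.
move=> wh wa vN M.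
have MS n : (N + M n = M n.+1 + (p + q))%N by rewrite /M; lia.
have w n : wle (M n) (iter n (br h) a).
  elim: n => [|n IH]; first by rewrite /M mul0n addn0.
  by have [] := br_tp sP q_gt0 qp wh IH (MS n).
by move=> n; split=> //; have [] := br_tp sP q_gt0 qp wh (w n) (MS n).
Qed.

(** With nonzero top forms, the weights of the iterates would grow by N - (p + q) > 0 at each step,
    while the orbit lies in a finite-dimensional space and has bounded weight. *)
Lemma iter_br_tp_eventually0 N M0 a : wle N h -> wle M0 a -> (p + q < N)%N ->
  exists n, tp (M0 + n * (N - (p + q))) (iter n (br h) a) = 0.
Proof.
move=> wh wa vN; have [B hB] := locfin_wle p q a sP hfin.
by exists B.+1; apply: (wle_tp0 (hB _)); nia.
Qed.

(** The orbit of X is used because its top form 1 vanishes nowhere. If N >= (p + q)(k + 1), then N n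
    k < (M n)(k + 1) for all n, the surplus 2q (k + 1) coming from the weight of X, and no iterate
    would lose its top form. *)
Lemma root_multiplicity N k x F1 : wle N h -> (p + q < N)%N ->
  tp N h = F1 * ('X - x%:P) ^+ k.+1 -> F1.[x] != 0 -> (N < (p + q) * k.+1)%N.
Proof.
move=> wh vN FE F1x; rewrite ltnNge; apply/negP => hk.
have [wX _ _] := wle_gens sP q_gt0 qp; have [tX _ _] := tp_gens sP q_gt0 qp.
have it := iter_br_tp wh wX vN; have [n0 /eqP] := iter_br_tp_eventually0 wh wX vN.
apply/negP; apply: (iter_root_neq0 (u := 2 * q) (N := N) _ (fun n => (it n).2) FE F1x).
- by rewrite muln_gt0.
- by rewrite mul0n addn0 /= tX hornerC oner_neq0.
- move=> n; nia.
Qed.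

(** Here a^i is the exact power of a in the top form, that is, the root at infinity. The orbit of Y,
    whose top form has degree 2, plays the role of that of X at a finite root. *)
Lemma top_degree N i j : wle N h -> (p + q < N)%N ->
  size (tp N h) = j.+1 -> (i * q + j * p = N)%N -> (0 < i)%N -> (j < i)%N.
Proof.
move=> wh vN sF ijN i0; rewrite ltnNge; apply/negP => ij.
have [_ _ wY] := wle_gens sP q_gt0 qp; have [_ _ tY] := tp_gens sP q_gt0 qp.
have it := iter_br_tp wh wY vN; have [n0 /eqP] := iter_br_tp_eventually0 wh wY vN.
case: j ij sF ijN => [|j] ij sF ijN; first by lia.
apply/negP; apply: (iter_degree_neq0 (u := 2 * q) (N := N) _ (fun n => (it n).2) sF (d := 1)).
- by rewrite muln_gt0.
- by rewrite mul0n addn0 /= tY size_polyN size_polyXn.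
move=> n; rewrite neq_ltn; apply/orP; left.
set W := (N - (p + q))%N; have WE : (W + (p + q) = N)%N by rewrite /W; lia.
(* With d = j + 1 - i, the two sides differ by 2 i q + n q d, which is positive because i and q
   are. *)
have [d dE] : exists d, j.+1 = (i + d)%N by exists (j.+1 - i)%N; lia.
have e1 : ((p + q) * j.+1 = N + q * d)%N by rewrite -ijN mulnDl {2}dE; lia.
have e2 : (N * j = W * j.+1 + q * d)%N.
  have : (N * j.+1 = W * j.+1 + (p + q) * j.+1)%N by rewrite -mulnDl WE.
  by rewrite e1 mulnS; lia.
have e3 : (N * (2 + n * j) = 2 * N + n * (N * j))%N by lia.
have e4 : ((2 * p + n * W) * j.+1 = 2 * (j.+1 * p) + n * (W * j.+1))%N by lia.
rewrite e3 e4 e2 mulnDr -ijN.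
have := muln_gt0 i q; rewrite i0 q_gt0 /=; lia.
Qed.

End Frame.
End NewtonPolygon.

(** For q <= p one has pq/(p + q) >= q/2, so two multiplicities above this bound overfill a form of
    degree q. *)
Fact two_multiplicities p q k l :
  (q <= p -> p * q < (p + q) * k -> p * q < (p + q) * l -> q < k + l)%N.
Proof.
move=> qp hk hl; rewrite ltnNge; apply/negP => kl.
have : ((p + q) * (k + l) <= (p + q) * q)%N by rewrite leq_mul2l kl orbT.
have h : (q * q <= p * q)%N by rewrite leq_mul2r qp orbT.
by rewrite mulnDr [((p + q) * q)%N]mulnDl; lia.
Qed.

Fact low_multiplicity p q i j k :
  (j < i -> k <= j -> (p + q) * k <= i * q + j * p)%N.
Proof.
move=> ji kj; have : ((p + q) * k <= (p + q) * j)%N by rewrite leq_mul2l kj orbT.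
have : (j * q <= i * q)%N by rewrite leq_mul2r (ltnW ji) orbT.
by rewrite mulnDl; lia.
Qed.

(** * Straightening h by shears *)

Section Straightening.
Variables (K : numClosedFieldType) (lam : K) (A : algType K) (h : A).
Hypothesis hfin : locfin h.

(** The p by q box is the smallest one containing the support of h, and weights q, p for a, b put
    its corners a^p and b^q on the same weight line pq. *)
Lemma top_form_root X H Y s p q c n N :
  is_symbol lam X H Y s -> (0 < q)%N -> (q <= p)%N -> expands X H Y c n h ->
  (forall i j, c i j != 0 -> (i <= p)%N && (j <= q)%N) ->
  (exists j, c p j != 0) -> (exists i, c i q != 0) ->
  (forall i j, c i j != 0 -> (i * q + j * p <= N)%N) ->
  tp s p q N h != 0 -> (p + q < N)%N ->
  [/\ N = (p * q)%N, exists k, p = (q * k.*2.+1)%N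
    & exists x, root (tp s p q N h) x].
Proof.
move=> sP q0 qp hE cpq [jp cp] [iq cq] cN F0 vN.
have wh := expands_wle sP q0 qp hE cN.
have FE i j ijN := coef_expands_tp sP q0 qp hE cN (i := i) (j := j) ijN.
have Fn j := coef_expands_tp_neq0 sP q0 qp hE cN (j := j).
set F := tp s p q N h in F0 FE Fn *.
have Nge : (p * q <= N)%N by have := cN _ _ cq; nia.
have lF : F`_(size F).-1 != 0 by rewrite -lead_coefE lead_coef_eq0.
have sF : size F = (size F).-1.+1 by rewrite prednK // lt0n size_poly_eq0.
have [i1 ijN c1] := Fn _ lF.
have /andP[i1p j1q] := cpq _ _ c1.
have mult x k F1 : F = F1 * ('X - x%:P) ^+ k -> (0 < k)%N -> F1.[x] != 0 ->
    (N < (p + q) * k)%N.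
  case: k => // k FE1 _ F1x.
  exact: (root_multiplicity hfin sP q0 qp wh vN FE1 F1x).
(* If N > pq, the box forces both exponents of the leading monomial to be positive, and 0 to be a
   root. Its multiplicity is at most the degree, which [top_degree] puts below i1: too small for
   [root_multiplicity]. *)
have [NE|Nne] := eqVneq N (p * q)%N; last first.
  exfalso; have Ngt : (p * q < N)%N by rewrite ltn_neqAle eq_sym Nne.
  have i1_gt0 : (0 < i1)%N by nia.
  have j1_gt0 : (0 < (size F).-1)%N by nia.
  have ji := top_degree hfin sP q0 qp wh vN sF ijN i1_gt0.
  have r0 : root F 0.
    rewrite rootE horner_coef0; apply: contraT => /Fn [i iN ci].
    by have /andP[ip _] := cpq _ _ ci; nia.
  have [k [F1 /implyP/(_ F0) F1x FE1]] := multiplicity_XsubC F 0.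
  have F1n : F1 != 0 by apply: contraNneq F1x => ->; rewrite root0.
  have k0 : (0 < k)%N.
    rewrite lt0n; apply: contraNneq F1x => k0; move: r0.
    by rewrite FE1 k0 expr0 mulr1.
  have := mult 0 k F1 FE1 k0 F1x.
  rewrite ltnNge => /negP; apply; rewrite -ijN; apply: low_multiplicity ji _.
  have sF1 : (size F1 + k = size F)%N.
    by rewrite FE1 size_Mmonic ?monic_exp ?monicXsubC // size_exp_XsubC addnS.
  have s1 : size F1 != 0%N by rewrite size_poly_eq0.
  by clear -sF1 s1; move: sF1 s1; move: (size F1) (size F) => a b; lia.
have p0 : (0 < p)%N by lia.
have jp0 : jp = 0%N by have := cN _ _ cp; nia.
have iq0 : iq = 0%N by have := cN _ _ cq; nia.
rewrite {}jp0 in cp; rewrite {}iq0 in cq.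
have F00 : F`_0 != 0 by rewrite (@FE p 0%N) ?mulf_neq0 ?kap_neq0 //; lia.
have Fqq : F`_q != 0 by rewrite (@FE 0%N q) ?mulf_neq0 ?kap_neq0 //; lia.
have sFq : size F = q.+1.
  apply/eqP; rewrite eqn_leq {1}sF ltnS j1q /=.
  by rewrite ltnNge; apply: contra Fqq => /leq_sizeP ->.
have pev : ~~ odd p by have /and3P[] := hE.1 _ _ cp; rewrite addn0.
have [x rx] : exists x, root F x.
  by apply/closed_rootP; rewrite sFq eqSS -lt0n.
have [k [F1 /implyP/(_ F0) F1x FE1]] := multiplicity_XsubC F x.
have F1n : F1 != 0 by apply: contraNneq F1x => ->; rewrite root0.
have k0 : (0 < k)%N.
  rewrite lt0n; apply: contraNneq F1x => k0; move: rx.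
  by rewrite FE1 k0 expr0 mulr1.
have Nk := mult x k F1 FE1 k0 F1x.
have sF1 : (size F1 + k = q.+1)%N.
  by rewrite -sFq FE1 size_Mmonic ?monic_exp ?monicXsubC // size_exp_XsubC addnS.
have s1 : size F1 = 1%N.
  apply/eqP; apply: contraT => s1.
  have [y ry] := closed_rootP F1 s1.
  have [l [F2 /implyP/(_ F1n) F2y FE2]] := multiplicity_XsubC F1 y.
  have F2n : F2 != 0 by apply: contraNneq F2y => ->; rewrite root0.
  have l0 : (0 < l)%N.
    rewrite lt0n; apply: contraNneq F2y => l0; move: ry.
    by rewrite FE2 l0 expr0 mulr1.
  have yx : y != x by apply: contraNneq F1x => <-.
  have FE3 : F = F2 * ('X - x%:P) ^+ k * ('X - y%:P) ^+ l.
    by rewrite FE1 FE2 mulrAC.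
  have Nl : (N < (p + q) * l)%N.
    apply: mult FE3 l0 _; rewrite hornerM horner_exp hornerXsubC mulf_neq0 //.
    by rewrite expf_neq0 // subr_eq0.
  have sF2 : (size F2 + l = size F1)%N.
    by rewrite FE2 size_Mmonic ?monic_exp ?monicXsubC // size_exp_XsubC addnS.
  have s2 : (0 < size F2)%N by rewrite lt0n size_poly_eq0.
  rewrite NE in Nk Nl; have kl := two_multiplicities qp Nk Nl.
  by clear -sF1 sF2 s2 kl; move: sF1 sF2 s2; move: (size F1) (size F2) => a b; lia.
have kq : k = q by move: sF1; rewrite s1 add1n => -[].
have F1C : F1 = (F1`_0)%:P by apply: size1_polyC; rewrite s1.
have x0 : x != 0.
  by apply: contraNneq F00 => x0; rewrite -horner_coef0 -rootE -[X in root _ X]x0.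
(* F is now a constant times ('X - x)^q with x nonzero, so its linear coefficient survives and some
   a^i b occurs in h. Then i is odd, p is even, and equality of weights gives q (p - i) = p. *)
have F10 : F`_1 != 0.
  have -> : F`_1 = F^`()`_0 by rewrite coef_deriv.
  rewrite -horner_coef0 FE1 F1C mul_polyC derivZ deriv_exp derivXsubC mul1r.
  rewrite hornerZ hornerMn horner_exp hornerXsubC sub0r mulf_neq0 //.
    by apply: contraNneq F1n => e0; rewrite F1C e0.
  by rewrite mulrn_eq0 negb_or -lt0n k0 expf_neq0 // oppr_eq0.
have [i iN ci] := Fn _ F10.
have iev : ~~ odd (i + 1) by have /and3P[] := hE.1 _ _ ci.
split=> //; last by exists x.
exists ((p - i).-1)./2.
have qpi : (q * (p - i) = p)%N.
  by rewrite mulnBr [(q * p)%N]mulnC -NE -iN mul1n [(q * i)%N]mulnC addKn.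
have pi0 : (0 < p - i)%N by rewrite lt0n; apply: contraTneq p0 => e0; rewrite -qpi e0 muln0.
suff -> : (((p - i).-1)./2).*2.+1 = (p - i)%N by [].
by clear -pev iev pi0; lia.
Qed.

(** In the sheared frame the top form is F('X - t) with t = - x: its constant coefficient F(x) = 0
    removes a^N, and its degree is unchanged. *)
Lemma shear_step X H Y s k c n N x :
  presents lam X H Y -> is_symbol lam X H Y s -> expands X H Y c n h ->
  let r := k.*2.+1 in
  (forall i j, c i j != 0 -> (i + j * r <= N)%N) ->
  root (tp s r 1 N h) x ->
  exists X' H' Y' c' n', [/\ presents lam X' H' Y', expands X' H' Y' c' n' h,
    forall i j, c' i j != 0 -> (i + j * r <= N)%N, c' N 0%N = 0
    & forall i j, c' i j != 0 -> (i + j * r = N)%N -> (j < size (tp s r 1 N h))%N].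
Proof.
move=> XP sP hE r cN rx; have [t tE] : exists t, - t = x by exists (- x); rewrite opprK.
(* With weights 1 and r for a and b, X^(k+1) weighs as much as H, while X^k H and X^(2k+1) weigh as
   much as Y; X^k is lighter than Y and drops out of the top form. *)
have [eQ ePH ePQ eP] : [/\ k.+1 * (2 * 1) = r + 1, k * (2 * 1) + (r + 1) = 2 * r,
    k * (2 * 1) + k.+1 * (2 * 1) = 2 * r & k * (2 * 1) < 2 * r]%N.
  by rewrite /r; clear; split; lia.
have XP' := presents_shear t k XP.
set H' := shearH t k X H in XP'; set Y' := shearY t k X H Y in XP'.
have [s' sP'] := presents_symbol XP'.
have [c' [n' hE']] := expandableT XP' h.
have r1 : (1 <= r)%N by [].
have [wX wH' wY'] := wle_gens sP' (ltn0Sn 0) r1.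
have [tX tH' tY'] := tp_gens sP' (ltn0Sn 0) r1.
have HE : H = H' + (2%:R * t) *: X ^+ k.+1 by rewrite /H' /shearH subrK.
have YE : Y = Y' + (- t) *: (X ^+ k * H') + (- (t * k%:R)) *: X ^+ k
    + (- t ^+ 2) *: (X ^+ k * X ^+ k.+1).
  rewrite /Y' /shearY {1}HE mulrDr -scalerAr; lincomb K.
clearbody H' Y'.
have wleM' := wleM sP' (ltn0Sn 0) r1; have tpM' := tpM sP' (ltn0Sn 0) r1.
have [wQ tQ] := wleX_tp sP' (ltn0Sn 0) r1 k.+1 wX.
have [wP tP] := wleX_tp sP' (ltn0Sn 0) r1 k wX.
rewrite tX expr1n in tQ; rewrite tX expr1n in tP.
have wPH := wleM' _ _ _ _ wP wH'; have tPH := tpM' _ _ _ _ wP wH'.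
have wPQ := wleM' _ _ _ _ wP wQ; have tPQ := tpM' _ _ _ _ wP wQ.
rewrite ePH in wPH; rewrite ePH tP tH' mul1r in tPH.
rewrite ePQ in wPQ; rewrite ePQ tP tQ mul1r in tPQ; rewrite eQ in wQ tQ.
have wH : wle s' r 1 (r + 1) H.
  by rewrite HE; exact: (wleD sP' wH' (wleZ sP' _ wQ)).
have wP2 : wle s' r 1 (2 * r) (X ^+ k) by exact: wleW wP (ltnW eP).
have wY : wle s' r 1 (2 * r) Y.
  have wZ := wleZ sP'; have wD := wleD sP'.
  by rewrite YE; exact: (wD _ _ _ _ _ (wD _ _ _ _ _ (wD _ _ _ _ _ wY' (wZ _ _ _ _ _ wPH))
    (wZ _ _ _ _ _ wP2)) (wZ _ _ _ _ _ wPQ)).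
have tH : tp s' r 1 (r + 1) H = - 2%:R * ('X - t%:P).
  by rewrite HE (tpD sP') (tpZ sP') tH' tQ polyCM rmorph_nat; ring.
have tY : tp s' r 1 (2 * r) Y = - ('X - t%:P) ^+ 2.
  rewrite YE !(tpD sP') !(tpZ sP') tY' tPH tPQ (wle_tp0 wP eP).
  ring.
have cN1 i j : c i j != 0 -> (i * 1 + j * r <= N)%N by rewrite muln1; apply: cN.
have wh := expands_wle_gen sP' (ltn0Sn 0) r1 wX wH wY tX tH tY hE cN1.
have th := expands_tp_gen sP' (ltn0Sn 0) r1 wX wH wY tX tH tY hE cN1.
have th0 := expands_tp sP (ltn0Sn 0) r1 hE cN1.
have {th0}thE : tp s' r 1 N h = tp s r 1 N h \Po ('X - t%:P).
  rewrite th th0 raddf_sum; apply: eq_bigr => i _ /=.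
  rewrite raddf_sum; apply: eq_bigr => j _ /=.
  by rewrite comp_polyM comp_polyC comp_Xn_poly.
have cN' i j : c' i j != 0 -> (i * 1 + j * r <= N)%N.
  exact: (expands_wleP sP' (ltn0Sn 0) r1 hE' wh).
have FE' i j ijN := coef_expands_tp sP' (ltn0Sn 0) r1 hE' cN' (i := i) (j := j) ijN.
exists X, H', Y', c', n'; split=> // [i j /cN'||i j cij ijN].
- by rewrite muln1.
- have := FE' N 0%N; rewrite muln1 mul0n addn0 => /(_ erefl).
  rewrite thE -horner_coef0 horner_comp hornerXsubC sub0r tE (rootP rx) => /esym/eqP.
  by rewrite mulf_eq0 (negPf (kap_neq0 _ _ _)) orbF => /eqP.
- have e1 : (tp s' r 1 N h)`_j != 0.
    by rewrite (@FE' i j) ?muln1 // mulf_neq0 // kap_neq0.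
  rewrite ltnNge; apply: contra e1 => sj; apply/eqP/nth_default.
  by rewrite thE size_comp_poly2 ?size_XsubC.
Qed.

End Straightening.

Section Induction.
Variables (K : numClosedFieldType) (lam : K) (A : algType K) (h e : A).
Hypothesis hfin : locfin h.
Hypotheses (e_neq0 : e != 0) (he : br h e = 2%:R *: e).

Lemma two_scale_neq0 : 2%:R *: e != 0.
Proof. by rewrite scaler_eq0 negb_or pnatr_eq0. Qed.

Lemma h_neq0 : h != 0.
Proof.
apply: contraNneq two_scale_neq0 => h0.
by rewrite -he h0 /br mul0r mulr0 subrr.
Qed.

(* If b does not occur in h then ad h strictly lowers the weight once b is heavy enough. *)
Lemma occurs_b X H Y c n : presents lam X H Y -> expands X H Y c n h ->
  ~ (forall i j, c i j != 0 -> j = 0%N).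
Proof.
move=> XP hE cj; have [s sP] := presents_symbol XP.
have [d [m eE]] := expandableT XP e.
have q1 : (1 <= n.+1)%N by [].
have [M [dM tM]] := expands_max sP (ltn0Sn 0) q1 eE e_neq0.
have wh : wle s n.+1 1 n h.
  apply: (expands_wle sP (ltn0Sn 0) q1 hE) => i j cij.
  have /and3P[_ hi _] := hE.1 _ _ cij.
  by rewrite (cj _ _ cij) muln1 mul0n addn0 ltnW.
have we := expands_wle sP (ltn0Sn 0) q1 eE dM.
have := br_tp0 sP (ltn0Sn 0) q1 wh we (i := M).
rewrite he (tpZ sP) addnC ltn_add2l addn1 leqnSn => /(_ isT)/eqP.
by rewrite mulf_eq0 (negPf tM) orbF polyC_eq0 pnatr_eq0.
Qed.

Definition straight := exists X' H' Y' g c0,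
  presents lam X' H' Y' /\ h = g *: H' + c0 *: (1 : A).

Lemma straighten_step m :
  (forall p q X H Y c n, (p + q < m)%N -> presents lam X H Y ->
     expands X H Y c n h -> (forall i j, c i j != 0 -> (i <= p)%N && (j <= q)%N) ->
     straight) ->
  forall p q X H Y c n, (p + q < m.+1)%N -> (q <= p)%N -> presents lam X H Y ->
     expands X H Y c n h -> (forall i j, c i j != 0 -> (i <= p)%N && (j <= q)%N) ->
     straight.
Proof.
move=> IH p q X H Y c n pqm qp XP hE cpq.
have [q0|q0] := posnP q.
  case: (occurs_b XP hE) => i j cij; have /andP[_] := cpq _ _ cij.
  by rewrite q0 leqn0 => /eqP.
have p0 : (0 < p)%N := leq_trans q0 qp.
have [attp|/forallNP natp] := pselect (exists j, c p j != 0); last first.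
  apply: (IH p.-1 q X H Y c n _ XP hE); first by clear -pqm p0; lia.
  move=> i j cij; have /andP[ip ->] := cpq _ _ cij; rewrite andbT -ltnS prednK //.
  by rewrite ltn_neqAle ip andbT; apply/eqP => ipE; apply: (natp j); rewrite -ipE.
have [attq|/forallNP natq] := pselect (exists i, c i q != 0); last first.
  apply: (IH p q.-1 X H Y c n _ XP hE); first by clear -pqm q0; lia.
  move=> i j cij; have /andP[-> jq] := cpq _ _ cij; rewrite /= -ltnS prednK //.
  by rewrite ltn_neqAle jq andbT; apply/eqP => jqE; apply: (natq i); rewrite -jqE.
have [s sP] := presents_symbol XP.
have [N [cN tN]] := expands_max sP q0 qp hE h_neq0.
(* After the shear a^p is gone and all other monomials satisfy i < p, so the box loses a column; the
   last premise keeps its height at most q. *)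
have shear k x : let r := k.*2.+1 in
    (forall i j, c i j != 0 -> (i + j * r <= p)%N) -> root (tp s r 1 p h) x ->
    (forall i j, (i + j * r <= p)%N ->
       ((i + j * r = p)%N -> (j < size (tp s r 1 p h))%N) -> (j <= q)%N) ->
    straight.
  move=> r cr rx jq.
  have [X' [H' [Y' [c' [n' [XP' hE' c'p c'0 c'F]]]]]] := shear_step XP sP hE cr rx.
  apply: (IH p.-1 q X' H' Y' c' n' _ XP' hE'); first by clear -pqm p0; lia.
  move=> i j cij; have ijp := c'p _ _ cij; apply/andP; split; last first.
    by apply: (jq i) => //; apply: c'F.
  rewrite -ltnS prednK // ltn_neqAle (leq_trans (leq_addr _ _) ijp) andbT.
  apply/eqP => ip; move: ijp; rewrite ip -{2}[p]addn0 leq_add2l leqn0 muln_eq0 orbF.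
  by move=> /eqP j0; move: cij; rewrite ip j0 c'0 eqxx.
have [vN|Nv] := ltnP (p + q) N.
  have [NE [k pE] [x rx]] := top_form_root hfin sP q0 qp hE cpq attp attq cN tN vN.
  have cond i j : (i * q + j * p = q * (i + j * k.*2.+1))%N.
    by rewrite pE; clear; lia.
  have cr i j : c i j != 0 -> (i + j * k.*2.+1 <= p)%N.
    by move=> /cN; rewrite cond NE mulnC leq_pmul2r.
  apply: (shear k x cr).
    rewrite (expands_tp sP (ltn0Sn 0) (ltn0Sn _) hE (N := p)); last first.
      by move=> i j /cr; rewrite muln1.
    move: rx; rewrite (expands_tp sP q0 qp hE cN).
    congr (is_true (root _ x)); apply: eq_bigr => i _; apply: eq_bigl => j.
    by rewrite cond NE muln1 mulnC eqn_pmul2r.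
  move=> i j ijp _; rewrite -(leq_pmul2r (ltn0Sn k.*2)) -pE.
  exact: leq_trans (leq_addl _ _) ijp.
(* Now h is no heavier than ab. A monomial containing b^q already weighs at least pq, so pq <= p +
   q, which leaves q = 1 or p = q = 2. *)
have [iq cq] := attq; have [jp cp] := attp.
have Nge : (iq * q + q * p <= p + q)%N := leq_trans (cN _ _ cq) Nv.
have [q1|q1] := eqVneq q 1%N.
  have cp1 i j : c i j != 0 -> (i + j * p <= p + 1)%N.
    by move=> /cN; rewrite q1 muln1 => ijN; apply: leq_trans ijN _; rewrite -q1.
  have c1 i : c i 1%N != 0 -> i = 1%N.
    move=> ci; have := cp1 _ _ ci; have /and3P[ev _ _] := hE.1 _ _ ci.
    by clear -ev; lia.
  have iq1 : iq = 1%N by apply: c1; rewrite -q1.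
  have [p1|p1] := eqVneq p 1%N.
    have hE2 : expands X H Y c 2 h.
      by apply: (expands_narrow hE) => i j /cpq; rewrite p1 q1.
    have z01 : c 0%N 1%N = 0 by apply/eqP; apply: contraT => /(hE.1).
    have z10 : c 1%N 0%N = 0 by apply/eqP; apply: contraT => /(hE.1).
    exists X, H, Y, (c 1%N 1%N), (c 0%N 0%N); split=> //.
    rewrite hE2.2 !big_ord_recl !big_ord0 /= z01 z10 !scale0r !addr0 add0r addrC.
    by rewrite /Z /= !expr0 !mul1r expr1.
  have jp0 : jp = 0%N.
    by have := cp1 _ _ cp; clear -p0 p1; nia.
  have /and3P[pev _ _] := hE.1 _ _ cp; rewrite jp0 addn0 in pev.
  (* The shear exponent r = 2k + 1 is p - 1, which gives a^p and ab the same weight; the top form is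
     linear and has a root. *)
  have [k pE] : exists k, p = k.*2.+2.
    by exists (p.-2)./2; clear -pev p0 p1; lia.
  have cr i j : c i j != 0 -> (i + j * k.*2.+1 <= p)%N.
    move=> cij; have /andP[ip jq] := cpq _ _ cij; rewrite q1 in jq.
    case: j jq cij => [|[|//]] _ cij; first by rewrite mul0n addn0.
    by rewrite (c1 _ cij) mul1n pE.
  have cr1 i j : c i j != 0 -> (i * 1 + j * k.*2.+1 <= p)%N by rewrite muln1; apply: cr.
  have F1 : (tp s k.*2.+1 1 p h)`_1 != 0.
    rewrite (coef_expands_tp sP (ltn0Sn 0) (ltn0Sn _) hE cr1 (i := 1)); last first.
      by rewrite pE !mul1n.
    by rewrite mulf_neq0 ?kap_neq0 //; move: cq; rewrite iq1 q1.
  have sF : size (tp s k.*2.+1 1 p h) = 2%N.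
    apply/eqP; rewrite eqn_leq; apply/andP; split; last first.
      by rewrite ltnNge; apply: contra F1 => /leq_sizeP ->.
    apply/leq_sizeP => j j2; apply/eqP; apply: contraLR j2.
    move=> /(coef_expands_tp_neq0 sP (ltn0Sn 0) (ltn0Sn _) hE cr1) [i _ cij].
    by have /andP[_] := cpq _ _ cij; rewrite q1 -ltnNge.
  have [x rx] : exists x, root (tp s k.*2.+1 1 p h) x by apply/closed_rootP; rewrite sF.
  apply: (shear k x cr rx) => i j; rewrite sF q1 leq_eqVlt => /orP[/eqP ijp /(_ ijp) //|].
  rewrite {1}pE ltnS => ijp _; have : (j * k.*2.+1 <= 1 * k.*2.+1)%N.
    by rewrite mul1n; apply: leq_trans (leq_addl _ _) ijp.
  by rewrite leq_pmul2r.
have [p2 q2] : p = 2%N /\ q = 2%N by clear -Nge q0 q1 qp; nia.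
(* Here h has degree at most 2 in a, b: a linear shear along a root of its quadratic form removes
   a^2. *)
have cr i j : c i j != 0 -> (i + j * 1 <= p)%N.
  by move=> /cN; rewrite p2 q2 in Nv *; clear -Nv; lia.
have cr1 i j : c i j != 0 -> (i * 1 + j * 1 <= p)%N by rewrite muln1; apply: cr.
have iq0 : iq = 0%N by move: Nge; rewrite p2 q2; clear; lia.
have F2 : (tp s 1 1 p h)`_2 != 0.
  rewrite (coef_expands_tp sP (ltn0Sn 0) (leqnn 1) hE cr1 (i := 0)) ?p2 //.
  by rewrite mulf_neq0 ?kap_neq0 //; move: cq; rewrite iq0 q2.
have [x rx] : exists x, root (tp s 1 1 p h) x.
  by apply/closed_rootP; apply: contraNneq F2 => s1; rewrite nth_default ?s1.
apply: (shear 0 x cr rx) => i j; rewrite p2 q2 muln1 => ijp _.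
exact: leq_trans (leq_addl _ _) ijp.
Qed.

Lemma straighten (X H Y : A) : presents lam X H Y -> straight.
Proof.
move=> XP; have [c [n hE]] := expandableT XP h.
suff main m : forall p q X H Y c n, (p + q < m)%N -> presents lam X H Y ->
     expands X H Y c n h -> (forall i j, c i j != 0 -> (i <= p)%N && (j <= q)%N) ->
     straight.
  apply: (main (n + n).+1 n n X H Y c n) => // i j /(hE.1) /and3P[_ hi hj].
  by rewrite (ltnW hi) (ltnW hj).
elim: m => [|m IH] // p q X1 H1 Y1 c1 n1 pqm XP1 hE1 cpq.
have [qp|pq] := leqP q p; first exact: (straighten_step IH pqm qp XP1 hE1 cpq).
apply: (straighten_step IH (p := q) (q := p) _ (ltnW pq) (presents_swap XP1) (expands_swap hE1)).
  by rewrite addnC.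
by move=> i j; rewrite mulf_eq0 negb_or andbC => /andP[/cpq]; rewrite andbC.
Qed.

End Induction.

(** * Bracket identities that detect lambda^2 *)

Section LieIdentities.
Variables (K : numFieldType) (lam : K) (A : algType K) (X H Y : A).
Hypothesis rel : sl2_rel lam X H Y.
Implicit Types g l : {poly K}.

(** Elements are written X^i g(T) with T = H/2, because moving g past X or Y shifts T by 1 or -1;
    brackets become polynomial arithmetic, with [kap] the polynomial for Y X. *)
Let T : A := 2%:R^-1 *: H.
Let hz g : A := horner_alg T g.
Let mon i g : A := X ^+ i * hz g.
Let sh (c : K) g : {poly K} := g \Po ('X + c%:P).
Let ell : K := 4%:R^-1 * (lam ^+ 2 - 1).
Let kap : {poly K} := ell%:P - 'X - 'X^2.

Fact n2 : 2%:R != 0 :> K. Proof. by rewrite pnatr_eq0. Qed.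

Lemma H_halves : H = hz (2%:R * 'X).
Proof.
rewrite /hz rmorphM rmorph_nat /= horner_algX /T mulr_natl -scaler_nat scalerA.
by rewrite mulfV ?n2 // scale1r.
Qed.

Lemma hz_shift x k g : T * x = x * T + k *: x -> hz g * x = x * hz (sh k g).
Proof.
move=> Tx; elim/poly_ind: g => [|g c IH].
  by rewrite /hz /sh comp_poly0 !rmorph0 mul0r mulr0.
have -> : hz (g * 'X + c%:P) = hz g * T + c *: 1.
  by rewrite /hz rmorphD rmorphM /= horner_algX horner_algC.
have -> : hz (sh k (g * 'X + c%:P)) = hz (sh k g) * (T + k *: 1) + c *: 1.
  rewrite /sh comp_polyD comp_polyM comp_polyX comp_polyC /hz.
  by rewrite rmorphD rmorphM rmorphD /= horner_algX !horner_algC.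
rewrite mulrDl -mulrA Tx !mulrDr -!scalerAr -scalerAl !mulrA IH mul1r !mulr1.
lincomb K.
Qed.

Lemma hz_mulX n g : hz g * X ^+ n = X ^+ n * hz (sh n%:R g).
Proof.
apply: hz_shift; rewrite /T -scalerAl (rel_HXn rel) scalerDr scalerA -scalerAr natrM mulrA.
by rewrite mulVf ?n2 // mul1r.
Qed.

Lemma hz_mulY g : hz g * Y = Y * hz (sh (- 1) g).
Proof.
apply: hz_shift.
by rewrite /T -scalerAl (rel_HY rel) scalerBr scalerA mulVf ?n2 // scale1r -scalerAr scaleN1r.
Qed.

Lemma hz_kap : Y * X = hz kap.
Proof.
have -> : hz kap = ell *: 1 - T - T * T.
  by rewrite /hz /kap !rmorphB rmorphXn /= horner_algX horner_algC.
rewrite (rel_YX rel) /T -scalerAl -scalerAr scalerA; congr (_ - _ - _ *: _).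
by rewrite -invfM -natrM.
Qed.

Lemma XY_kap : X * Y = hz (kap + 2%:R * 'X).
Proof. by rewrite (rel_XY rel) hz_kap [X in _ + X]H_halves -[LHS]rmorphD. Qed.

Lemma monM i j g l : mon i g * mon j l = mon (i + j) (sh j%:R g * l).
Proof.
by rewrite /mon mulrA -(mulrA _ (hz g)) hz_mulX mulrA -exprD -mulrA /hz -rmorphM.
Qed.

Lemma br_mon i j g l : br (mon i g) (mon j l) =
  mon (i + j) (sh j%:R g * l - sh i%:R l * g).
Proof. by rewrite /br !monM addnC /mon /hz rmorphB mulrBr. Qed.

Lemma brY_mon i g : br Y (mon i.+1 g) =
  mon i (sh i%:R kap * g - (kap + 2%:R * 'X) * sh (- 1) g).
Proof.
have e1 : Y * mon i.+1 g = mon i (sh i%:R kap * g).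
  by rewrite /mon exprS !mulrA hz_kap hz_mulX -mulrA -rmorphM.
have e2 : mon i.+1 g * Y = mon i ((kap + 2%:R * 'X) * sh (- 1) g).
  by rewrite /mon -mulrA hz_mulY exprSr -mulrA (mulrA X) XY_kap -rmorphM.
by rewrite /br e1 e2 /mon -mulrBr -rmorphB.
Qed.

Lemma scale_mon c i g : c *: mon i g = mon i (c%:P * g).
Proof. by rewrite /mon /hz rmorphM /= horner_algC -scalerAl mul1r scalerAr. Qed.

Lemma monD i g l : mon i g + mon i l = mon i (g + l).
Proof. by rewrite /mon /hz rmorphD mulrDr. Qed.

Lemma X_mon : X = mon 1 1.
Proof. by rewrite /mon /hz rmorph1 mulr1 expr1. Qed.
Lemma X2_mon : X ^+ 2 = mon 2 1.
Proof. by rewrite /mon /hz rmorph1 mulr1. Qed.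

Let quad (a b c : K) : {poly K} := a%:P * 'X ^+ 2 + b%:P * 'X + c%:P.

Fact sh_quad k a b c : sh k (quad a b c) =
  a%:P * ('X + k%:P) ^+ 2 + b%:P * ('X + k%:P) + c%:P.
Proof.
by rewrite /sh /quad !(comp_polyD, comp_polyM, comp_polyC, comp_polyX).
Qed.

Fact kapE : kap = quad (- 1) (- 1) ell.
Proof. rewrite /kap /quad; ring. Qed.

Let u := X ^+ 2.
Let b1 := br Y u.
Let b2 := br Y b1.
Let z := br u b1.
Let c1 := br Y z.

Fact b1E : b1 = mon 1 (quad 0 (- 4%:R) (- 2%:R)).
Proof.
have -> : b1 = br Y (mon 2 (quad 0 0 1)).
  by rewrite /b1 /u X2_mon /quad; congr (br _ (mon _ _)); ring.
by rewrite brY_mon kapE !sh_quad /quad; congr (mon _ _); ring.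
Qed.

Fact b2E : b2 = mon 0 (quad 12%:R 0 (- 4%:R * ell)).
Proof. by rewrite /b2 b1E brY_mon kapE !sh_quad /quad; congr (mon _ _); ring. Qed.

Fact zE : z = mon 3 (quad 0 0 8%:R).
Proof.
have -> : z = br (mon 2 (quad 0 0 1)) b1.
  by rewrite /z /u X2_mon /quad; congr (br (mon _ _) _); ring.
by rewrite b1E br_mon !sh_quad /quad; congr (mon _ _); ring.
Qed.

Fact c1E : c1 = mon 2 (quad 0 (- 48%:R) (- 48%:R)).
Proof. by rewrite /c1 zE brY_mon kapE !sh_quad /quad; congr (mon _ _); ring. Qed.

(** Under ad sl(2), X^2 generates a module of dimension 5, whose exterior square is the sum of the
    module of z = 8 X^3 and the adjoint one. The coefficients 5 and 2 cancel the former and leave a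
    multiple of X. Both brackets are quadratic in u, which produces the factor c^2 when u is
    rescaled by c. *)
Lemma lie_identity1 :
  5%:R *: br b1 b2 = 2%:R *: br Y (br Y z) + (24%:R * (lam ^+ 2 - 4%:R)) *: X.
Proof.
have -> : br Y (br Y z) = mon 1 (quad 240%:R 240%:R (96%:R - 48%:R * ell)).
  by rewrite -/c1 c1E brY_mon kapE !sh_quad /quad; congr (mon _ _); ring.
have -> : 24%:R * (lam ^+ 2 - 4%:R) = 96%:R * ell - 72%:R.
  by rewrite /ell; field.
rewrite [x in _ + _ *: x]X_mon b1E b2E br_mon !scale_mon monD !sh_quad /quad; congr (mon _ _); ring.
Qed.

(** Here the part in the module of X^4 is cancelled and a multiple of X^2 remains. The brackets are
    cubic in u and the remainder is linear, so rescaling u gives c^2 again. *)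
Lemma lie_identity2 :
  7%:R *: br b2 c1 = - 3%:R *: br Y (br Y (br u c1))
    - (576%:R * (lam ^+ 2 - 9%:R)) *: u.
Proof.
have -> : br u c1 = mon 4 (quad 0 0 96%:R).
  have -> : u = mon 2 (quad 0 0 1).
    by rewrite /u X2_mon /quad; congr (mon _ _); ring.
  by rewrite c1E br_mon !sh_quad /quad; congr (mon _ _); ring.
have -> : br Y (mon 4 (quad 0 0 96%:R)) = mon 3 (quad 0 (- 768%:R) (- 1152%:R)).
  by rewrite brY_mon kapE !sh_quad /quad; congr (mon _ _); ring.
have -> : br Y (mon 3 (quad 0 (- 768%:R) (- 1152%:R)))
    = mon 2 (quad 5376%:R 10752%:R (6912%:R - 768%:R * ell)).
  by rewrite brY_mon kapE !sh_quad /quad; congr (mon _ _); ring.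
have -> : 576%:R * (lam ^+ 2 - 9%:R) = 2304%:R * ell - 4608%:R.
  by rewrite /ell; field.
rewrite /u X2_mon b2E c1E br_mon -scaleNr !scale_mon monD !sh_quad /quad.
congr (mon _ _); ring.
Qed.

End LieIdentities.

(** * Eigenvectors of ad H and sl(2)-triples *)

Section EigenExpansion.
Variables (K : numFieldType) (lam : K) (A : algType K) (X H Y : A).
Hypothesis XP : presents lam X H Y.

Lemma brDr (a b c : A) : br a (b + c) = br a b + br a c.
Proof. by rewrite /br mulrDr mulrDl opprD addrACA. Qed.
Lemma brZr k (a b : A) : br a (k *: b) = k *: br a b.
Proof. by rewrite /br -scalerAl -scalerAr scalerBr. Qed.
Lemma brDl (a b c : A) : br (a + b) c = br a c + br b c.
Proof. by rewrite /br mulrDr mulrDl opprD addrACA. Qed.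
Lemma brZl k (a b : A) : br (k *: a) b = k *: br a b.
Proof. by rewrite /br -scalerAl -scalerAr scalerBr. Qed.
Lemma br1l (a : A) : br 1 a = 0.
Proof. by rewrite /br mul1r mulr1 subrr. Qed.

Lemma br_sumr (I : finType) (a : A) (F : I -> A) :
  br a (\sum_i F i) = \sum_i br a (F i).
Proof.
apply: (big_morph (br a)) => [b c|]; first exact: brDr.
by rewrite /br mulr0 mul0r subrr.
Qed.

Lemma expands_adH c n a : expands X H Y c n a ->
  expands X H Y (fun i j => (i%:R - j%:R) * c i j) n (br H a).
Proof.
move=> [cP aE]; split=> [i j|].
  by rewrite mulf_eq0 negb_or => /andP[_ /cP].
rewrite aE br_sumr; apply: eq_bigr => i _; rewrite br_sumr; apply: eq_bigr => j _.
have [->|/cP /and3P[ev _ _]] := eqVneq (c i j) 0.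
  by rewrite mulr0 !scale0r /br mulr0 mul0r subrr.
by rewrite brZr (ad_H_Z XP) // scalerA mulrC.
Qed.

Lemma expands0_coef c n i j : expands X H Y c n 0 -> c i j = 0.
Proof.
move=> E; have [s sP] := presents_symbol XP.
have c0 := expands_wleP sP (ltn0Sn 0) (leqnn 1) E (wle0 sP 1 1 0).
apply/eqP; apply: contraT => cij; have := c0 _ _ cij.
rewrite !muln1 leqn0 addn_eq0 => /andP[/eqP i0 /eqP j0].
have := coef_expands_tp sP (ltn0Sn 0) (leqnn 1) E c0 (i := i) (j := j).
rewrite i0 j0 => /(_ erefl); rewrite (tp0 sP) coef0 => /esym/eqP.
by rewrite mulf_eq0 (negPf (kap_neq0 _ _ _)) orbF -[X in c X]i0 -j0 (negPf cij).
Qed.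

Lemma eigen_support mu c n a : br H a = mu *: a -> expands X H Y c n a ->
  forall i j, c i j != 0 -> i%:R - j%:R = mu.
Proof.
move=> Ha E i j cij; have E1 := expandsD (expands_adH E) (expandsZ (- mu) E).
rewrite Ha scaleNr subrr in E1; have /eqP := expands0_coef i j E1.
by rewrite -mulrDl mulf_eq0 (negPf cij) orbF subr_eq0 => /eqP.
Qed.

Lemma expands_single c n a i0 j0 : expands X H Y c n a ->
  (forall i j, c i j != 0 -> i = i0 /\ j = j0) -> a = c i0 j0 *: Z X H Y i0 j0.
Proof.
move=> E sup; have [c0|c0] := eqVneq (c i0 j0) 0.
  rewrite c0 scale0r E.2 big1 // => i _; rewrite big1 // => j _.
  have [->|cij] := eqVneq (c i j) 0; first by rewrite scale0r.
  by have [ii jj] := sup _ _ cij; rewrite ii jj c0 eqxx in cij.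
have /and3P[_ hi hj] := E.1 _ _ c0.
rewrite E.2 (bigD1 (Ordinal hi)) //= [X in _ + X]big1 ?addr0; last first.
  move=> i /eqP ii; rewrite big1 // => j _.
  have [->|/sup [e _]] := eqVneq (c i j) 0; first by rewrite scale0r.
  by case: ii; apply: val_inj.
rewrite (bigD1 (Ordinal hj)) //= big1 ?addr0 // => j /eqP jj.
have [->|/sup [_ e]] := eqVneq (c i0 j) 0; first by rewrite scale0r.
by case: jj; apply: val_inj.
Qed.

(** Meant for eigenvectors of ad H: there i - j is fixed, so the total degree separates the
    monomials and only one can reach the top. *)
Lemma top_monomial s c n a : is_symbol lam X H Y s -> expands X H Y c n a -> a != 0 ->
  (forall i j i' j', c i j != 0 -> c i' j' != 0 -> (i + j = i' + j')%N -> j = j') ->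
  exists i0 j0 k, [/\ c i0 j0 != 0, k != 0, wle s 1 1 (i0 + j0) a,
    forall i j, c i j != 0 -> (i + j <= i0 + j0)%N & tp s 1 1 (i0 + j0) a = k%:P * 'X^j0].
Proof.
move=> sP E a0 uniq; have [N [cN tN]] := expands_max sP (ltn0Sn 0) (leqnn 1) E a0.
have Fn j := coef_expands_tp_neq0 sP (ltn0Sn 0) (leqnn 1) E cN (j := j).
have wa := expands_wle sP (ltn0Sn 0) (leqnn 1) E cN.
have lF : (tp s 1 1 N a)`_(size (tp s 1 1 N a)).-1 != 0.
  by rewrite -lead_coefE lead_coef_eq0.
have [i0 iN c0] := Fn _ lF; set j0 := _.-1 in iN c0 lF; rewrite !muln1 in iN.
exists i0, j0, (tp s 1 1 N a)`_j0; rewrite iN; split=> // [i j /cN|].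
  by rewrite !muln1.
apply/polyP => j; rewrite coefCM coefXn.
case: eqP => [->|jj]; rewrite ?mulr1 // mulr0; apply/eqP; apply: contraT => /Fn.
case=> i; rewrite !muln1 => ijN cij; case: jj.
by apply: (uniq i j i0 j0) => //; rewrite ijN iN.
Qed.

End EigenExpansion.

Lemma horner1_deriv_mono (K : numFieldType) (x : K) j :
  ((x%:P * 'X^j)^`()).[1] = x * j%:R.
Proof. by rewrite mul_polyC derivZ derivXn hornerZ hornerMn hornerXn expr1n. Qed.

Lemma horner_natr (K : numFieldType) (x : K) n : (n%:R : {poly K}).[x] = n%:R.
Proof. by rewrite -(rmorph_nat polyC) hornerC. Qed.

Section Triples.
Variables (K : numClosedFieldType) (lam : K) (A : algType K).

Lemma triple_presents_aux (X H Y : A) (g c0 : K) (m : nat) (e h f : A) :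
  presents lam X H Y -> h = g *: H + c0 *: 1 -> g * m%:R = 2%:R -> e != 0 ->
  br e f = h -> br h e = 2%:R *: e -> br h f = - (2%:R *: f) ->
  presents lam e h f.
Proof.
move=> XP hE gm e0 ef he hf; have [s sP] := presents_symbol XP.
have n2 : 2%:R != 0 :> K by rewrite pnatr_eq0.
have g0 : g != 0 by apply: contraNneq n2 => g0; rewrite -gm g0 mul0r.
have m0 : (0 < m)%N by rewrite lt0n; apply: contraNneq n2 => m0; rewrite -gm m0 mulr0.
have h0 := h_neq0 e0 he.
have f0 : f != 0.
  by apply: contraNneq h0 => f0; rewrite -ef f0 /br mulr0 mul0r subrr.
have brh a : br h a = g *: br H a by rewrite hE brDl !brZl br1l scaler0 addr0.
have He : br H e = m%:R *: e.
  by apply: (scalerI g0); rewrite -brh he scalerA gm.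
have Hf : br H f = (- m%:R) *: f.
  by apply: (scalerI g0); rewrite -brh hf scalerA mulrN gm scaleNr.
have [c [n eE]] := expandableT XP e; have [d [n' fE]] := expandableT XP f.
have ce i j : c i j != 0 -> i = (j + m)%N.
  move=> /(eigen_support XP He eE)/eqP.
  by rewrite subr_eq -natrD eqr_nat addnC => /eqP.
have df i j : d i j != 0 -> j = (i + m)%N.
  move=> /(eigen_support XP Hf fE)/eqP.
  by rewrite subr_eq addrC -subr_eq opprK -natrD eqr_nat eq_sym => /eqP.
have ue i j i' j' : c i j != 0 -> c i' j' != 0 -> (i + j = i' + j')%N -> j = j'.
  by move=> /ce -> /ce ->; clear; lia.
have uf i j i' j' : d i j != 0 -> d i' j' != 0 -> (i + j = i' + j')%N -> j = j'.
  by move=> /df -> /df ->; clear; lia.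
have [i0 [j0 [k [cij k0 we cle te]]]] := top_monomial sP eE e0 ue.
have [i1 [j1 [l [dij l0 wf dle tf]]]] := top_monomial sP fE f0 uf.
have i0E := ce _ _ cij; have j1E := df _ _ dij.
have /and3P[ev _ _] := eE.1 _ _ cij.
have [_ wH _] := wle_gens sP (ltn0Sn 0) (leqnn 1).
have wh : wle s 1 1 2 h.
  rewrite hE; apply: (wleD sP); first exact: (wleZ sP _ wH).
  by apply: (wleZ sP); apply: wleW (wle1 sP 1 1) _.
have NN : (i0 + j0 + (i1 + j1) = (i0 + j0 + (i1 + j1) - 2) + (1 + 1))%N.
  by rewrite i0E j1E; clear -m0; lia.
have [_] := br_tp sP (ltn0Sn 0) (leqnn 1) we wf NN.
rewrite ef te tf; set i := (_ - 2)%N => th.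
(* The top forms are monomials, so evaluation at 1 just reads off coefficients. That of [e, f] is a
   nonzero multiple of k l m (m + i1 + j0), hence [e, f] = h has degree exactly i. *)
have ile : (i <= 2)%N.
  rewrite leqNgt; apply/negP => /(wle_tp0 wh) t0; move: th; rewrite t0 mulr0.
  move=> /(congr1 (fun P : {poly K} => P.[1])).
  have hX j : ('X^j : {poly K}).[1] = 1 by rewrite hornerXn expr1n.
  rewrite horner0 hornerD hornerN !hornerM !horner1_deriv_mono !horner_natr !hornerC !hX !mulr1.
  have -> : (i0 + j0)%:R * k * (l * j1%:R) - (i1 + j1)%:R * (k * j0%:R) * l
    = k * l * (m * (m + i1 + j0))%:R.
    by rewrite i0E j1E !(natrM, natrD); ring.
  move/esym/eqP; rewrite !mulf_eq0 (negPf k0) (negPf l0) pnatr_eq0 /=.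
  by rewrite muln_eq0 !addn_eq0 (gtn_eqF m0).
(* The degree bound reads m + j0 + i1 <= 2, and m is even because e involves only monomials of even
   degree. *)
have [m2 j00 i10] : [/\ m = 2, j0 = 0 & i1 = 0]%N.
  by move: ile ev; rewrite /i i0E j1E; clear -m0; split; lia.
have eZ : e = c 2%N 0%N *: X.
  rewrite {1}(expands_single (i0 := 2) (j0 := 0) eE).
    by rewrite /Z /= expr0 mulr1 expr1.
  move=> i' j' cij'; have := cle _ _ cij'; have := ce _ _ cij'.
  by rewrite i0E j00 m2; clear; lia.
have fZ : f = d 0%N 2%N *: Y.
  rewrite {1}(expands_single (i0 := 0) (j0 := 2) fE).
    by rewrite /Z /= expr0 mulr1 expr1.
  move=> i' j' dij'; have := dle _ _ dij'; have := df _ _ dij'.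
  by rewrite j1E i10 m2; clear; lia.
move: (c 2%N 0%N) (d 0%N 2%N) eZ fZ => x y eZ fZ.
have [XY HX _ _] := XP.1.
have hxy : h = (x * y) *: H by rewrite -ef eZ fZ brZl brZr scalerA /br XY.
have xy1 : x * y = 1.
  have : 2%:R *: e = (x * y) *: (2%:R *: e).
    by rewrite -{1}he hxy brZl He m2.
  move/eqP; rewrite scalerA -subr_eq0 -scalerBl scaler_eq0 (negPf e0) orbF.
  by rewrite -{1}[2%:R]mul1r -mulrBl mulf_eq0 (negPf n2) orbF subr_eq0 eq_sym => /eqP.
have x0 : x != 0 by apply: contraNneq e0 => x0; rewrite eZ x0 scale0r.
have -> : h = H by rewrite hxy xy1 scale1r.
have yE : y = x^-1 by rewrite -[RHS]mulr1 -xy1 mulKf.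
by rewrite eZ fZ yE; apply: presents_torus.
Qed.

(** No Casimir relation is assumed for (e, h, f): local finiteness of ad h supplies it, with the
    same lambda. *)
Theorem triple_presents (X H Y e h f : A) :
  presents lam X H Y -> locfin h -> e != 0 ->
  br e f = h -> br h e = 2%:R *: e -> br h f = - (2%:R *: f) ->
  presents lam e h f.
Proof.
move=> XP hfin e0 ef he hf.
have [X' [H' [Y' [g [c0 [XP' hE]]]]]] := straighten hfin e0 he XP.
have n2 : 2%:R != 0 :> K by rewrite pnatr_eq0.
have brh a : br h a = g *: br H' a by rewrite hE brDl !brZl br1l scaler0 addr0.
have g0 : g != 0.
  apply: contraNneq e0 => g0; have /esym/eqP := he; rewrite brh g0 scale0r.
  by rewrite scaler_eq0 (negPf n2).
have He : br H' e = (2%:R / g) *: e.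
  by apply: (scalerI g0); rewrite -brh he scalerA mulrC divfK.
have [c [n eE]] := expandableT XP' e.
have [i [j cij]] : exists i j, c i j != 0.
  apply: contrapT => /forallNP nc; case/eqP: e0; rewrite eE.2.
  rewrite big1 // => i _; rewrite big1 // => j _.
  have [->|cij] := eqVneq (c i j) 0; first by rewrite scale0r.
  by case: (nc i); exists j.
have gij : g * (i%:R - j%:R) = 2%:R.
  by rewrite (eigen_support XP' He eE cij) mulrC divfK.
(* If e lowers the H'-weight, the swapped presentation makes it a raising element. *)
have [ji|ij] := leqP j i.
  by apply: (triple_presents_aux (m := i - j) XP' hE) => //; rewrite natrB.
apply: (triple_presents_aux (m := j - i) (g := - g) (presents_swap XP')) => //.
- by rewrite scalerN scaleNr opprK hE.
- by rewrite natrB 1?ltnW // mulNr -mulrN opprB.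
Qed.

(** Bracketing with X differentiates the top form, so [X, u] = 0 leaves no b in it, and weight 4
    then leaves only X^2. *)
Lemma highest_weight4 (X H Y u : A) : presents lam X H Y ->
  br H u = 4%:R *: u -> br X u = 0 -> exists c, u = c *: X ^+ 2.
Proof.
move=> XP Hu Xu; have [->|u0] := eqVneq u 0; first by exists 0; rewrite scale0r.
have [s sP] := presents_symbol XP; have [c [n uE]] := expandableT XP u.
have cu i j : c i j != 0 -> i = (j + 4)%N.
  move=> /(eigen_support XP Hu uE)/eqP.
  by rewrite subr_eq -natrD eqr_nat addnC => /eqP.
have uu i j i' j' : c i j != 0 -> c i' j' != 0 -> (i + j = i' + j')%N -> j = j'.
  by move=> /cu -> /cu ->; clear; lia.
have [i0 [j0 [k [cij k0 wu cle tu]]]] := top_monomial sP uE u0 uu.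
have [wX _ _] := wle_gens sP (ltn0Sn 0) (leqnn 1).
have [tX _ _] := tp_gens sP (ltn0Sn 0) (leqnn 1).
have [_] := br_tp sP (ltn0Sn 0) (leqnn 1) wX wu (i := i0 + j0) (addnC _ _).
have d1 : (1 : {poly K})^`() = 0 by rewrite -polyC1 derivC.
rewrite Xu (tp0 sP) tX tu d1 !mulr0 mul0r subr0 mulr1.
move=> /(congr1 (fun P : {poly K} => P.[1])).
rewrite horner0 hornerM horner1_deriv_mono horner_natr => /esym/eqP.
rewrite !mulf_eq0 (negPf k0) !pnatr_eq0 /= => /eqP j00.
exists (c 4%N 0%N); rewrite {1}(expands_single (i0 := 4) (j0 := 0) uE).
  by rewrite /Z /= expr0 mulr1.
move=> i j cij'; have := cle _ _ cij'; have := cu _ _ cij'.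
by rewrite (cu _ _ cij) j00; clear; lia.
Qed.

End Triples.

(** L and D are the two brackets of a Lie identity; transport by w rescales both by the same r, so
    they are eliminated together. *)
Lemma compare_scaled (K : fieldType) (V : lmodType K) (L D x : V) (a b r k1 k2 : K) :
  (a * r) *: L = (b * r) *: D + k1 *: x -> a *: L = b *: D + k2 *: x -> x != 0 ->
  k1 = r * k2.
Proof.
move=> E1 E2 x0; apply/eqP; rewrite -subr_eq0.
suff /eqP : (k1 - r * k2) *: x = 0 by rewrite scaler_eq0 (negPf x0) orbF.
rewrite scalerBl; apply/eqP; rewrite subr_eq0; apply/eqP.
apply: (addrI ((b * r) *: D)); rewrite -E1 ![_ * r]mulrC -!scalerA E2.
by rewrite scalerDr.
Qed.

(** * Antilinear automorphisms and reality of lambda^2 *)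

Section AntilinearAutomorphism.
Variables (K : numClosedFieldType) (lam : K) (A : algType K) (X H Y : A).
Hypothesis XP : presents lam X H Y.
Variable w : A -> A.
Hypotheses (wD : forall x y, w (x + y) = w x + w y).
Hypotheses (wZ : forall (a : K) x, w (a *: x) = a^* *: w x).
Hypotheses (wB : forall x y, w (br x y) = br (w x) (w y)).
Hypotheses (wK : forall x, w (w x) = x).

Lemma antilinear_sum (I : finType) (F : I -> A) : w (\sum_i F i) = \sum_i w (F i).
Proof.
by apply: (big_morph w wD); have := wZ 0 0; rewrite scale0r conjC0 scale0r.
Qed.

(** w conjugates ad (w H) into ad H, which is diagonal on monomials; the eigenvalues and
    coefficients are merely conjugated. *)
Lemma locfin_image : locfin (w H).
Proof.
move=> a; have [c [n aE]] := expandableT XP (w a).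
exists ('I_n * 'I_n)%type, (fun ij : 'I_n * 'I_n => w (Z X H Y ij.1 ij.2)) => m.
exists (fun ij : 'I_n * 'I_n => ((ij.1%:R - ij.2%:R) ^+ m * c ij.1 ij.2)^*).
have -> : iter m (br (w H)) a = w (iter m (br H) (w a)).
  by elim: m => [|m IH] /=; rewrite ?wK // wB IH.
have : expands X H Y (fun i j => (i%:R - j%:R) ^+ m * c i j) n (iter m (br H) (w a)).
  elim: m => [|m IH] /=.
    suff -> : (fun i j => (i%:R - j%:R) ^+ 0 * c i j) = c by [].
    by apply/funext => i; apply/funext => j; rewrite expr0 mul1r.
  have := expands_adH XP IH.
  suff -> : (fun i j : nat => (i%:R - j%:R) * ((i%:R - j%:R) ^+ m * c i j))
    = (fun i j => (i%:R - j%:R) ^+ m.+1 * c i j) by [].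
  by apply/funext => i; apply/funext => j; rewrite exprS mulrA.
case=> _ ->; rewrite pair_bigA antilinear_sum; apply: eq_bigr => ij _ /=.
by rewrite wZ.
Qed.

Theorem antilinear_aut_real : lam ^+ 2 \is Num.real.
Proof.
have [rXY rHX rHY _] := XP.1; have w0 : w 0 = 0.
  by have := wZ 0 0; rewrite scale0r conjC0 scale0r.
have wN a : w (- a) = - w a by rewrite -scaleN1r wZ rmorphN1 scaleN1r.
have w_inj a : w a = 0 -> a = 0 by move=> e; rewrite -(wK a) e w0.
have n2 : (2%:R : K)^* = 2%:R by rewrite conjC_nat.
have X0 (X1 H1 Y1 : A) : presents lam X1 H1 Y1 -> X1 ^+ 2 != 0.
  move=> P1; have [s sP] := presents_symbol P1.
  have [wX _ _] := wle_gens sP (ltn0Sn 0) (leqnn 1).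
  have [tX _ _] := tp_gens sP (ltn0Sn 0) (leqnn 1).
  have [_ t2] := wleX_tp sP (ltn0Sn 0) (leqnn 1) 2 wX.
  apply: contra_eq_neq t2 => ->; rewrite (tp0 sP) tX expr1n eq_sym.
  exact: oner_neq0.
have Xn0 (X1 H1 Y1 : A) : presents lam X1 H1 Y1 -> X1 != 0.
  by move=> /X0; apply: contraNneq => ->; rewrite expr0n.
have wX0 : w X != 0 by apply: contraNneq (Xn0 _ _ _ XP) => /w_inj ->.
have ef : br (w X) (w Y) = w H by rewrite -wB /br rXY.
have he : br (w H) (w X) = 2%:R *: w X by rewrite -wB /br rHX wZ n2.
have hf : br (w H) (w Y) = - (2%:R *: w Y) by rewrite -wB /br rHY wN wZ n2.
(* From here on both Lie identities hold for (w X, w H, w Y) with the original lambda, to be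
   compared with their images under w, where lambda^2 is conjugated. *)
have XP' := triple_presents XP locfin_image wX0 ef he hf.
have [c uE] : exists c, w (X ^+ 2) = c *: w X ^+ 2.
  apply: (highest_weight4 XP').
  - rewrite -wB /br expr2 mulrA (rel_HX XP.1) mulrDl -(mulrA X H) (rel_HX XP.1) mulrDr.
    rewrite -!scalerAl -scalerAr mulrA; set v := (X * X); rewrite -[4%:R]conjC_nat -wZ.
    by congr w; lincomb K.
  - by rewrite -wB /br -exprS -exprSr subrr w0.
have c0 : c != 0.
  apply: contraNneq (X0 _ _ _ XP) => c0; apply/eqP/w_inj.
  by rewrite uE c0 scale0r.
pose a := lam ^+ 2.
have e1 : (a - 4%:R)^* = c ^+ 2 * (a - 4%:R).
  have Ew := congr1 w (lie_identity1 XP.1).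
  rewrite wD !wZ !wB uE !(brZr, brZl) !scalerA rmorphM /= !conjC_nat -/a in Ew.
  have := compare_scaled Ew (lie_identity1 XP'.1) wX0.
  by rewrite mulrCA -expr2 => /mulfI -> //; rewrite pnatr_eq0.
have e2 : (a - 9%:R)^* = c ^+ 2 * (a - 9%:R).
  have Ew := congr1 w (lie_identity2 XP.1).
  have q1 : (- 3%:R : K)^* = - 3%:R by rewrite rmorphN /= conjC_nat.
  have q2 : (- (576%:R * (lam ^+ 2 - 9%:R)))^* = - (576%:R * (a - 9%:R)^*).
    by rewrite rmorphN rmorphM /= conjC_nat.
  rewrite -scaleNr wD !wZ q1 q2 conjC_nat !wB uE !(brZr, brZl) !scalerA in Ew.
  have E' := lie_identity2 XP'.1; rewrite -scaleNr in E'.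
  have E := compare_scaled Ew E' (X0 _ _ _ XP').
  have k0 : - (576%:R * c) != 0 by rewrite oppr_eq0 mulf_neq0 // pnatr_eq0.
  apply: (mulfI k0); transitivity (- (576%:R * (a - 9%:R)^*) * c); first by ring.
  by rewrite E /a; ring.
have c21 : c ^+ 2 = 1.
  have : (a - 4%:R)^* - (a - 9%:R)^* = c ^+ 2 * 5%:R by rewrite e1 e2; ring.
  rewrite -rmorphB /=.
  have -> : a - 4%:R - (a - 9%:R) = 5%:R by ring.
  rewrite conjC_nat => /esym/eqP; rewrite -{2}[5%:R]mul1r => /eqP/mulIf -> //.
  by rewrite pnatr_eq0.
rewrite CrealE -/a; apply/eqP.
by move: e1; rewrite c21 mul1r rmorphB /= conjC_nat => /addIr.
Qed.

End AntilinearAutomorphism.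

Theorem theorem6p2 (R : realType) (lam : R[i]) (A : algType R[i])
  (X H Y : A) :
  lam ^+ 2 \isn't Num.real ->
  is_Alambda lam X H Y ->
  ~ exists w : A -> A, is_inv_antilinear_lie_aut w.
Proof.
move=> lamN AP [w [wD wZ wB wK]]; case/negP: lamN.
exact: (antilinear_aut_real (is_Alambda_presents AP) wD wZ wB wK).
Qed.
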